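(* Assume that $\mu \colon \mathcal{P}^2_o \to \mathbb{R}^{2\times 2}$ is a measurable valuation which is $\mathrm{GL}(2)$-covariant, i.e. $\mu(\phi P) = |\det\phi|\,\phi\,\mu(P)\,\phi^t$ for all $P \in \mathcal{P}^2_o$ and all $\phi \in \mathrm{GL}(2)$. Then there exists $k \in \mathbb{R}$ such that $\mu(P) = k\, M_2(P)$ for all $P \in \mathcal{P}^2_o$.
   Context: $\mathcal{P}^2_o$ denotes the set of convex polygons in $\mathbb{R}^2$ containing the origin in their interiors, with the Hausdorff metric topology; ''measurable'' refers to Borel $\sigma$-algebras. A map $\mu$ on a family $\mathcal{S}$ of sets is a valuation if $\mu(K \cup L) + \mu(K \cap L) = \mu(K) + \mu(L)$ whenever $K, L, K\cup L, K \cap L \in \mathcal{S}$. The moment matrix is $M_2(P) = \int_P x\,x^t\,dx$. *)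

(* Defs.v *)
From HB Require Import structures.
From mathcomp Require Import all_boot all_order all_algebra.
From mathcomp Require Import all_classical all_reals all_analysis.
Set Implicit Arguments. Unset Strict Implicit. Unset Printing Implicit Defensive.
Import Order.TTheory GRing.Theory Num.Theory.
Import numFieldNormedType.Exports.
Local Open Scope classical_set_scope.
Local Open Scope ring_scope.

Section Defs.
Variable R : realType.

Definition coord (x : R * R) (i : 'I_2) : R := if i == ord0 then x.1 else x.2.

Definition vec2 (x : R * R) : 'cV[R]_2 := \col_i coord x i.
Definition lin_act (phi : 'M[R]_2) (x : R * R) : R * R :=
  let v := phi *m vec2 x in (v ord0 ord0, v (lift ord0 ord0) ord0).

Definition mx_image (phi : 'M[R]_2) (P : set (R * R)) : set (R * R) :=
  lin_act phi @` P.

Definition edist (x y : R * R) : R :=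
  Num.sqrt ((x.1 - y.1) ^+ 2 + (x.2 - y.2) ^+ 2).

Definition conv_hull (s : seq (R * R)) : set (R * R) :=
  [set x | exists w : 'I_(size s) -> R,
     (forall i, 0 <= w i) /\ \sum_i w i = 1 /\
     x = (\sum_i w i * (nth (0,0) s i).1, \sum_i w i * (nth (0,0) s i).2)].

Definition convex_polygon (P : set (R * R)) : Prop :=
  exists s : seq (R * R), P = conv_hull s.

Definition P2o : set (set (R * R)) :=
  [set P | convex_polygon P /\ (interior P) (0, 0)].

Definition hausdorff_le (K L : set (R * R)) (e : R) : Prop :=
  (forall x, K x -> exists y, L y /\ edist x y <= e) /\
  (forall y, L y -> exists x, K x /\ edist x y <= e).

Definition hausdorff_open (U : set (set (R * R))) : Prop :=
  U `<=` P2o /\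
  forall P, U P -> exists2 e : R, 0 < e &
    forall Q, P2o Q -> hausdorff_le P Q e -> U Q.

Definition borel_P2o : set (set (set (R * R))) := <<s P2o, hausdorff_open >>.

Definition borel_mx : set (set 'M[R]_2) := <<s [set U : set 'M[R]_2 | open U] >>.

Definition measurable_P2o (mu : set (R * R) -> 'M[R]_2) : Prop :=
  forall B, borel_mx B -> borel_P2o (P2o `&` mu @^-1` B).

Definition valuation_P2o (mu : set (R * R) -> 'M[R]_2) : Prop :=
  forall K L, P2o K -> P2o L -> P2o (K `|` L) -> P2o (K `&` L) ->
    mu (K `|` L) + mu (K `&` L) = mu K + mu L.

Definition GL2_covariant (mu : set (R * R) -> 'M[R]_2) : Prop :=
  forall P (phi : 'M[R]_2), P2o P -> phi \in unitmx ->
    mu (mx_image phi P) = `|\det phi| *: (phi *m mu P *m phi^T).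

Definition leb2 := ((@lebesgue_measure R) \x (@lebesgue_measure R))%E.

Definition moment_matrix (P : set (R * R)) : 'M[R]_2 :=
  \matrix_(i, j) fine (\int[leb2]_(x in P) (coord x i * coord x j)%:E)%E.

End Defs.

(* Main.v *)
Require Import Defs.
From HB Require Import structures.
From mathcomp Require Import all_boot all_order all_algebra.
From mathcomp Require Import all_classical all_reals all_analysis.
From mathcomp Require Import measurable_realfun ring lra.
Set Implicit Arguments. Unset Strict Implicit. Unset Printing Implicit Defensive.
Import Order.TTheory GRing.Theory Num.Theory.
Import numFieldNormedType.Exports.
Local Open Scope classical_set_scope.
Local Open Scope ring_scope.

(** The moment matrix is itself a GL(2)-covariant valuation, and its (1,1)
    entry on the square with vertices (+-1, 0), (0, +-1) is not 0; subtracting a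
    multiple of it from mu yields a covariant valuation nu whose (1,1) entry
    vanishes on that square, and the claim is that nu = 0.

    Kites, i.e. quadrilaterals with both diagonals through the origin: cutting
    along a diagonal splits nu into functions of pairs of half-diagonals, and
    covariance under diagonal matrices and reflections makes the diagonal entries
    vanish and forces the off-diagonal ones to be homogeneous cocycles.

    Quadrilaterals with one diagonal through the origin: fix that diagonal and
    let the slopes of the two other vertices vary. Covariance under shears makes
    nu additive in the slope, while diag(1, 1/2) rescales the slope and the
    entries of nu incompatibly, so nu is determined by its values on kites. The
    triangle with vertices (1, 0), (0, 1), (-1, -1) is such a quadrilateral, and
    its symmetry under the exchange of coordinates kills the last free parameter.

    General polygons: cutting along a chord through the origin and completing
    both parts by points of the polygon costs only a quadrilateral of the previous
    kind. Repeated cuts reduce a polygon to sectors containing no generator in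
    their interior, and these are again such quadrilaterals. *)

(** * Convex hulls *)

Section Hulls.
Variable R : realType.
Implicit Types (x y l : R * R) (C P : set (R * R)) (s : seq (R * R)).

Definition mix (t : R) x y : R * R :=
  ((1 - t) * x.1 + t * y.1, (1 - t) * x.2 + t * y.2).

Definition is_convex C :=
  forall x y t, C x -> C y -> 0 <= t -> t <= 1 -> C (mix t x y).

Definition dotp l x : R := l.1 * x.1 + l.2 * x.2.

(** Lines off the origin are coded by their polar points: every closed half-plane with 0 in its
    interior has this form. *)
Definition halfplane l : set (R * R) := [set x | dotp l x <= 1].

Lemma is_convexI C P : is_convex C -> is_convex P -> is_convex (C `&` P).
Proof. by move=> cC cP x y t [Cx Px] [Cy Py] t0 t1; split; [exact: cC|exact: cP]. Qed.

Lemma halfplane_convex l : is_convex (halfplane l).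
Proof.
move=> x y t; rewrite /halfplane /dotp /mix /= => hx hy t0 t1.
have : 0 <= (1 - t) * (1 - (l.1 * x.1 + l.2 * x.2)).
  by apply: mulr_ge0; lra.
have : 0 <= t * (1 - (l.1 * y.1 + l.2 * y.2)) by apply: mulr_ge0; lra.
lra.
Qed.

(** Induction on the list: the normalised combination is a [mix] of the head with the normalised
    tail. Membership is asked only at positive weight, since [hull_clip] gives weight zero to points
    outside the half-plane. *)
Lemma convex_comb_seq C (I : eqType) (r : seq I) (w : I -> R) (p : I -> R * R) :
    is_convex C -> (forall i, i \in r -> 0 <= w i) ->
    (forall i, i \in r -> 0 < w i -> C (p i)) ->
  let W := \sum_(i <- r) w i in 0 < W ->
  C ((\sum_(i <- r) w i * (p i).1) / W, (\sum_(i <- r) w i * (p i).2) / W).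
Proof.
move=> cC; elim: r => [|i r IH] w0 Cp /=; first by rewrite big_nil ltxx.
rewrite !big_cons; set W := \sum_(j <- r) w j => W0.
have w0r j : j \in r -> 0 <= w j by move=> jr; rewrite w0 // inE jr orbT.
have Cpr j : j \in r -> 0 < w j -> C (p j).
  by move=> jr; apply: Cp; rewrite inE jr orbT.
have := IH w0r Cpr; rewrite -/W /= => {}IH.
have wi0 : 0 <= w i by rewrite w0 // inE eqxx.
have : 0 <= W by rewrite /W big_seq; apply: sumr_ge0.
rewrite le_eqVlt => /orP[/eqP W00|Wgt].
  have wr j : j \in r -> w j = 0.
    move=> jr; apply/eqP; move: W00 => /esym /eqP.
    rewrite /W big_seq psumr_eq0 //.
    by move=> /allP /(_ j jr); rewrite jr.
  have z (f : I -> R) : \sum_(j <- r) w j * f j = 0.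
    by rewrite big_seq big1 // => j /wr ->; rewrite mul0r.
  rewrite !z -W00 !addr0 in W0 *.
  have /Cp : i \in i :: r by rewrite inE eqxx.
  move=> /(_ W0); rewrite !(mulrC (w i)) !mulfK ?gt_eqF //.
  by case: (p i).
have {IH} := IH Wgt; move: wi0; rewrite le_eqVlt => /orP[/eqP <-|wip].
  by rewrite !add0r !mul0r !add0r.
have Cpi : C (p i) by apply: Cp; rewrite // inE eqxx.
set y := (X in C X) => Cy.
have := cC _ _ (W / (w i + W)) Cpi Cy.
have wW : w i + W != 0 by rewrite gt_eqF.
have WW : W != 0 by rewrite gt_eqF.
rewrite (_ : mix _ _ _ = ((w i * (p i).1 + \sum_(j <- r) w j * (p j).1) / (w i + W),
  (w i * (p i).2 + \sum_(j <- r) w j * (p j).2) / (w i + W))).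
  apply; first by rewrite divr_ge0 // ltW.
  by rewrite ler_pdivrMr // mul1r lerDr ltW.
by rewrite /mix /y /=; congr pair; field; rewrite wW WW.
Qed.

Lemma convex_comb C (I : finType) (w : I -> R) (p : I -> R * R) :
    is_convex C -> (forall i, 0 <= w i) -> \sum_i w i = 1 ->
    (forall i, 0 < w i -> C (p i)) ->
  C (\sum_i w i * (p i).1, \sum_i w i * (p i).2).
Proof.
move=> cC w0 w1 Cp.
have := @convex_comb_seq C I (index_enum I) w p cC (fun i _ => w0 i) (fun i _ => Cp i).
by rewrite /= w1 !divr1; apply.
Qed.

Lemma hull_convex s : is_convex (conv_hull s).
Proof.
move=> x y t [w [w0 [w1 ->]]] [v [v0 [v1 ->]]] t0 t1.
exists (fun i => (1 - t) * w i + t * v i); split=> [i|].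
  by rewrite addr_ge0 // mulr_ge0 // subr_ge0.
rewrite big_split /= -!mulr_sumr w1 v1; split; first by rewrite !mulr1 subrK.
rewrite /mix /=; congr pair; rewrite !mulr_sumr -big_split; apply: eq_bigr => i _ /=; ring.
Qed.

Lemma mem_hull s x : x \in s -> conv_hull s x.
Proof.
move=> xs; have xi : (index x s < size s)%N by rewrite index_mem.
exists (fun i => (i == Ordinal xi)%:R); split=> [i|]; first exact: ler0n.
have E (f : 'I_(size s) -> R) : \sum_i (i == Ordinal xi)%:R * f i = f (Ordinal xi).
  rewrite (bigD1 (Ordinal xi)) //= eqxx mul1r big1 ?addr0 // => i /negbTE ->.
  by rewrite mul0r.
split.
  by rewrite -[RHS](E (fun=> 1)); apply: eq_bigr => i _; rewrite mulr1.
rewrite (E (fun i => (nth (0, 0) s i).1)) (E (fun i => (nth (0, 0) s i).2)) /=.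
by rewrite nth_index //; case: x {xs xi E}.
Qed.

Lemma hull_min s C : is_convex C -> (forall x, x \in s -> C x) -> conv_hull s `<=` C.
Proof.
move=> cC sC x [w [w0 [w1 ->]]].
apply: (@convex_comb C _ w (fun i : 'I_(size s) => nth (0, 0) s i)) => // i _.
by apply: sC; rewrite mem_nth.
Qed.

Lemma polygon_convex P : convex_polygon P -> is_convex P.
Proof. by move=> [s ->]; exact: hull_convex. Qed.

Lemma dotp_sum l (I : finType) (w : I -> R) (p : I -> R * R) :
  dotp l (\sum_i w i * (p i).1, \sum_i w i * (p i).2) = \sum_i w i * dotp l (p i).
Proof.
rewrite /dotp /= !mulr_sumr -big_split /=; apply: eq_bigr => i _; ring.
Qed.

(* The clipped hull is generated by the old generators inside the half-plane and
   by the points where a segment between an inner and an outer one crosses its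
   boundary; the mass of each outer generator is moved to these crossing points,
   balanced by inner mass in proportion to its slack. *)
Lemma hull_clip s l : exists s', conv_hull s `&` halfplane l = conv_hull s'.
Proof.
pose a x := 1 - dotp l x.
pose z x y : R * R := mix (a x / (a x - a y)) x y.
exists ([seq x <- s | 0 <= a x] ++
  [seq z x y | x <- [seq x <- s | 0 <= a x], y <- [seq y <- s | a y < 0]]).
set s' := _ ++ _; apply/seteqP; split; last first.
  apply: hull_min => [|x].
    by apply: is_convexI; [exact: hull_convex|exact: halfplane_convex].
  rewrite mem_cat => /orP[|].
    rewrite mem_filter => /andP[ax xs]; split; first exact: mem_hull.
    by move: ax; rewrite /a subr_ge0.
  move=> /allpairsP [[p q] /= [pp qq ->]].
  move: pp qq; rewrite !mem_filter => /andP[ap ps] /andP[aq qs].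
  have D : 0 < a p - a q by lra.
  split.
    apply: hull_convex; [exact: mem_hull|exact: mem_hull| |].
      by rewrite divr_ge0 // ltW.
    by rewrite ler_pdivrMr // mul1r; lra.
  have : a (z p q) = 0.
    rewrite /a /z /mix /dotp /=; move: D; rewrite /a /dotp => D.
    by field; rewrite gt_eqF.
  by rewrite /a /halfplane /= => /eqP; rewrite subr_eq0 => /eqP <-.
move=> x [[w [w0 [w1 ->]]] xl].
pose p (i : 'I_(size s)) := nth (0, 0) s i.
have ps i : p i \in s by rewrite mem_nth.
(* [A] is the total slack of the inner generators and [B] the total excess of the outer ones;
   [B <= A] because the point itself lies in the half-plane. *)
pose A := \sum_(i | 0 <= a (p i)) w i * a (p i).
pose B := \sum_(i | a (p i) < 0) w i * - a (p i).
have nE i : ~~ (0 <= a (p i)) = (a (p i) < 0) by rewrite -ltNge.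
have BA : B <= A.
  move: xl; rewrite /halfplane /= (@dotp_sum l _ w p) => xl.
  have : \sum_i w i * a (p i) = 1 - \sum_i w i * dotp l (p i).
    by rewrite -w1 -sumrB; apply: eq_bigr => i _; rewrite /a mulrBr mulr1.
  rewrite (bigID (fun i => 0 <= a (p i))) /= -/A.
  under [X in _ + X]eq_bigl do rewrite nE.
  have -> : \sum_(i | a (p i) < 0) w i * a (p i) = - B.
    by rewrite /B -sumrN; apply: eq_bigr => i _; rewrite mulrN opprK.
  lra.
have A0 : 0 <= A by apply: sumr_ge0 => i ai; rewrite mulr_ge0.
have B0 : 0 <= B by apply: sumr_ge0 => i ai; rewrite mulr_ge0 // oppr_ge0 ltW.
have cs' := @hull_convex s'.
case: (ltgtP A 0) => [|Agt|A00]; first by rewrite ltNge A0.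
  (* An inner [p i] and an outer [p j] put mass [m i j] on their crossing point: summed over [i]
     this restores the term of [p j], summed over [j] it uses the fraction [B / A] of the weight of
     [p i]. *)
  pose m i j := w i * w j / A * (a (p i) - a (p j)).
  pose W (k : 'I_(size s) + 'I_(size s) * 'I_(size s)) := match k with
    | inl i => if 0 <= a (p i) then w i * (1 - B / A) else 0
    | inr ij => if (0 <= a (p ij.1)) && (a (p ij.2) < 0) then m ij.1 ij.2 else 0 end.
  pose Q (k : 'I_(size s) + 'I_(size s) * 'I_(size s)) := match k with
    | inl i => p i | inr ij => z (p ij.1) (p ij.2) end.
  (* Applied to the two coordinates and to the constant 1; the hypothesis on [f] is affinity along
     the crossing segments. *)
  have key (f : R * R -> R) : (forall i j, 0 <= a (p i) -> a (p j) < 0 ->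
      f (z (p i) (p j)) * (a (p i) - a (p j)) = a (p i) * f (p j) - a (p j) * f (p i)) ->
      \sum_k W k * f (Q k) = \sum_i w i * f (p i).
    move=> fz; rewrite big_sumType /= [RHS](bigID (fun i => 0 <= a (p i))) /=.
    under [X in _ = _ + X]eq_bigl do rewrite nE.
    have -> : \sum_(ij : 'I_(size s) * 'I_(size s))
       (if (0 <= a (p ij.1)) && (a (p ij.2) < 0) then m ij.1 ij.2 else 0) *
         f (z (p ij.1) (p ij.2)) =
       \sum_(i | 0 <= a (p i)) \sum_(j | a (p j) < 0)
         (w i * f (p i) * (w j * - a (p j)) / A + w i * a (p i) * (w j * f (p j)) / A).
      rewrite (pair_big (fun i => 0 <= a (p i)) (fun j => a (p j) < 0)) /=.
      rewrite [RHS]big_mkcond /=; apply: eq_bigr => -[i j] _ /=.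
      case: ifPn => [/andP[ai aj]|_]; last by rewrite mul0r.
      rewrite /m -[_ * _ * f _]mulrA [X in _ * X]mulrC fz //; field; exact: lt0r_neq0.
    under [X in _ + X]eq_bigr do
      rewrite big_split -!mulr_suml -!mulr_sumr -/B /=.
    rewrite big_split /= -!mulr_suml -/A.
    have -> : \sum_i (if 0 <= a (p i) then w i * (1 - B / A) else 0) * f (p i) =
      (\sum_(i | 0 <= a (p i)) w i * f (p i)) * (1 - B / A).
      rewrite mulr_suml [RHS]big_mkcond; apply: eq_bigr => i _.
      by case: ifP => _; rewrite ?mul0r // mulrAC.
    by field; exact: lt0r_neq0.
  have zE i j (f : R * R -> R) (fm : forall t x y, f (mix t x y) = (1 - t) * f x + t * f y) :
     0 <= a (p i) -> a (p j) < 0 ->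
      f (z (p i) (p j)) * (a (p i) - a (p j)) = a (p i) * f (p j) - a (p j) * f (p i).
    move=> ai aj; rewrite /z fm; field.
    by rewrite gt_eqF //; lra.
  rewrite (_ : (_, _) = (\sum_k W k * (Q k).1, \sum_k W k * (Q k).2)); last first.
    by rewrite (key fst) ?(key snd) // => i j; exact: zE.
  apply: (@convex_comb _ _ W Q cs').
  - case=> [i|[i j]] /=; case: ifP => //.
      by move=> _; rewrite mulr_ge0 // subr_ge0 ler_pdivrMr // mul1r.
    move=> /andP[ai aj]; rewrite /m mulr_ge0 //; last by lra.
    by rewrite divr_ge0 // mulr_ge0.
  - rewrite -[RHS]w1.
    transitivity (\sum_k W k * (fun=> 1) (Q k)).
      by apply: eq_bigr => k _; rewrite mulr1.
    rewrite (key (fun=> 1)); last by move=> i j _ _; ring.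
    by apply: eq_bigr => k _; rewrite mulr1.
  - case=> [i|[i j]] /=; case: ifP => //; rewrite ?ltxx //.
      by move=> ai _; apply: mem_hull; rewrite mem_cat mem_filter ai ps.
    move=> /andP[ai aj] _; apply: mem_hull; rewrite mem_cat; apply/orP; right.
    by apply/allpairsP; exists (p i, p j) => /=; rewrite !mem_filter ai aj !ps.
(* Without slack there is no excess either, so only inner generators carry weight. *)
have B00 : B = 0 by lra.
apply: (@convex_comb _ _ w p cs') => // i wi.
apply: mem_hull; rewrite mem_cat mem_filter ps andbT; apply/orP; left.
rewrite leNgt; apply/negP => ai.
move: B00; rewrite /B => /eqP; rewrite psumr_eq0; last first.
  by move=> j aj; rewrite mulr_ge0 // oppr_ge0 ltW.
move=> /allP /(_ i (mem_index_enum _)); rewrite ai /= mulf_eq0 oppr_eq0.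
by rewrite gt_eqF //= lt_eqF.
Qed.

End Hulls.

(** * Polygons around the origin *)

Section Polygons.
Variable R : realType.
Implicit Types (x y l : R * R) (C P : set (R * R)) (s : seq (R * R)).

Lemma nbhs0_box P : nbhs (0 : R, 0 : R) P <->
  exists2 e : R, 0 < e & forall x, `|x.1| < e -> `|x.2| < e -> P x.
Proof.
split=> [/nbhs_ballP[e e0 eP]|[e e0 eP]].
  by exists e => // -[x1 x2] /= h1 h2; apply: eP; split; rewrite /ball /= sub0r normrN.
apply/nbhs_ballP; exists e => // -[x1 x2] [/=].
by rewrite /ball /= !sub0r !normrN => h1 h2; exact: eP.
Qed.

Lemma nbhs0_halfplane l : nbhs (0 : R, 0 : R) (halfplane l).
Proof.
apply/nbhs0_box; exists (`|l.1| + `|l.2| + 1)^-1 => [|x h1 h2].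
  by rewrite invr_gt0; have := normr_ge0 l.1; have := normr_ge0 l.2; lra.
have a1 := normr_ge0 l.1; have a2 := normr_ge0 l.2.
set d := (_ + _ + 1) in h1 h2 *.
have d0 : 0 < d by rewrite /d; lra.
have b1 : `|l.1 * x.1| <= `|l.1| / d by rewrite normrM ler_wpM2l // ltW.
have b2 : `|l.2 * x.2| <= `|l.2| / d by rewrite normrM ler_wpM2l // ltW.
have b : (`|l.1| + `|l.2|) / d <= 1 by rewrite ler_pdivrMr // mul1r /d; lra.
have := ler_norm (l.1 * x.1); have := ler_norm (l.2 * x.2).
rewrite /halfplane /dotp /=; lra.
Qed.

(** * Clipping by finitely many half-planes *)

Definition cuts (ls : seq (R * R)) : set (R * R) :=
  [set x | all (fun l => dotp l x <= 1) ls].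

Lemma cuts_cons l ls : cuts (l :: ls) = halfplane l `&` cuts ls.
Proof.
by apply/seteqP; split=> x; rewrite /cuts /halfplane /=; [move=> /andP|move=> ?; apply/andP].
Qed.

(** [hull_clip] preserves polygons and each half-plane is a neighbourhood of 0, so all clipped
    pieces used later stay in [P2o]. *)
Lemma P2o_cuts P ls : P2o P -> P2o (P `&` cuts ls).
Proof.
elim: ls P => [|l ls IH] P PP.
  by rewrite (_ : P `&` _ = P) //; apply/seteqP; split=> x; [case|].
rewrite cuts_cons setIA; apply: IH; case: PP => -[s ->] i0.
split; last by rewrite interiorI; split => //; exact: nbhs0_halfplane.
by have [s' ->] := hull_clip s l; exists s'.
Qed.

Lemma P2o_convex P : P2o P -> is_convex P.
Proof. by case=> /polygon_convex. Qed.

Lemma P2o0 P : P2o P -> P (0, 0).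
Proof. by case=> _ /interior_subset. Qed.

Definition box (N : R) : set (R * R) := [set x | `|x.1| <= N /\ `|x.2| <= N].

Lemma P2o_box N : 0 < N -> P2o (box N).
Proof.
move=> N0; split; last first.
  by apply/nbhs0_box; exists N => // x /ltW h1 /ltW h2.
exists [:: (N, N); (N, - N); (- N, N); (- N, - N)].
have N2 : 0 < 2 * N by lra.
apply/seteqP; split; last first.
  apply: hull_min.
    move=> x y t [h1 h2] [h3 h4] t0 t1; have t1' : 0 <= 1 - t by lra.
    have tr (a b : R) : `|a| <= N -> `|b| <= N -> `|(1 - t) * a + t * b| <= N.
      move=> ha hb; apply: le_trans (ler_normD _ _) _; rewrite !normrM.
      rewrite (ger0_norm t0) (ger0_norm t1').
      have := ler_wpM2l t1' ha; have := ler_wpM2l t0 hb; lra.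
    by split; apply: tr.
  move=> x; rewrite !inE => /or4P[] /eqP ->;
    by split; rewrite /= ?normrN ger0_norm // ltW.
move=> [x1 x2] [/= h1 h2].
have bar (c : R) : `|c| <= N -> 0 <= (c + N) / (2 * N) /\ (c + N) / (2 * N) <= 1.
  rewrite ler_norml => /andP[h3 h4].
  by rewrite divr_ge0 ?ler_pdivrMr //; lra.
have [b10 b11] := bar _ h1; have [b20 b21] := bar _ h2.
set s := [:: _; _; _; _].
have cs := @hull_convex R s.
have edge (c : R) : c = N \/ c = - N -> conv_hull s (c, x2).
  move=> hc; have := cs (c, - N) (c, N) _ _ _ b20 b21.
  rewrite (_ : mix _ _ _ = (c, x2)); last first.
    by rewrite /mix /=; congr pair; field; rewrite gt_eqF.
  by apply; apply: mem_hull; case: hc => ->; rewrite !inE eqxx ?orbT.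
have := cs (- N, x2) (N, x2) _ (edge _ _) (edge _ _) b10 b11.
rewrite (_ : mix _ _ _ = (x1, x2)); last first.
  by rewrite /mix /=; congr pair; field; rewrite gt_eqF.
by apply; [right|left].
Qed.

(** A bounded intersection of half-planes is a large box clipped by them, which gives a polygon
    without listing its vertices. *)
Lemma P2o_bounded_cuts ls N : cuts ls `<=` box N -> P2o (cuts ls).
Proof.
move=> lsN; have M0 : 0 < `|N| + 1 by rewrite ltr_wpDl.
rewrite (_ : cuts ls = box (`|N| + 1) `&` cuts ls).
  by apply: P2o_cuts; exact: P2o_box.
apply/seteqP; split=> [x lx|x []//]; split=> //.
have [h1 h2] := lsN _ lx.
by split; [apply: le_trans h1 _|apply: le_trans h2 _];
  rewrite (le_trans (ler_norm N)) // lerDl.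
Qed.

(** Presents a hull as the join of one generator with the hull of the others, for the induction in
    [hull_compact]. For empty [s] the right-hand side would be empty. *)
Lemma hull_cons x s : s != [::] ->
  conv_hull (x :: s) = (fun z : R * (R * R) => mix z.1 x z.2) @` (`[0, 1] `*` conv_hull s).
Proof.
move=> s0; apply/seteqP; split; last first.
  move=> _ [[t y] [/= t01 ys] <-]; move: t01; rewrite /= in_itv /= => /andP[t0 t1].
  apply: hull_convex => //; first by apply: mem_hull; rewrite inE eqxx.
  apply: (hull_min _ _) ys => [|z zs]; first exact: hull_convex.
  by apply: mem_hull; rewrite inE zs orbT.
move=> y [w [w0 [w1 ->]]].
rewrite big_ord_recl /= in w1; rewrite !big_ord_recl /=.
set W := \sum_(i < size s) w (lift ord0 i) in w1.
have W0 : 0 <= W by apply: sumr_ge0.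
have w00 := w0 ord0.
(* When the tail has no mass, any of its points serves, with parameter 0. *)
move: W0; rewrite le_eqVlt => /orP[/eqP W0|Wp].
  have [y0 y0s] : exists y0, y0 \in s.
    by case: s s0 {w w0 w1 W W0 w00} => // y0 s _; exists y0; rewrite inE eqxx.
  have z (f : 'I_(size s) -> R) : \sum_i w (lift ord0 i) * f i = 0.
    apply: big1 => i _; move/esym/eqP: W0; rewrite psumr_eq0 //.
    by move=> /allP /(_ i (mem_index_enum _)) /eqP ->; rewrite mul0r.
  exists (0, y0).
    by split; [rewrite /= in_itv /= lexx ler01|exact: mem_hull].
  rewrite !z -W0 addr0 in w1 *; rewrite /mix /= w1.
  by congr pair; ring.
exists (W, ((\sum_(i < size s) w (lift ord0 i) * (nth (0,0) s i).1) / W,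
        (\sum_(i < size s) w (lift ord0 i) * (nth (0,0) s i).2) / W)).
  split; first by rewrite /= in_itv /= ltW //=; lra.
  apply: (@convex_comb_seq R _ _ (index_enum _) (fun i => w (lift ord0 i))
    (fun i : 'I_(size s) => nth (0,0) s i)) => //; first exact: hull_convex.
  by move=> i _ _; apply: mem_hull; rewrite mem_nth.
rewrite /mix /=; rewrite (_ : 1 - W = w ord0); last by lra.
by congr pair; field; rewrite gt_eqF.
Qed.

Lemma hull_compact s : compact (conv_hull s).
Proof.
elim: s => [|x s IH].
  rewrite (_ : conv_hull _ = set0); first exact: compact0.
  apply/seteqP; split=> // x [w [_ [+ _]]]; rewrite big_ord0 => /eqP.
  by rewrite eq_sym oner_eq0.
have [->|s0] := eqVneq s [::].
  rewrite (_ : conv_hull _ = [set x]); first exact: compact_set1.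
  apply/seteqP; split=> [|y ->]; last by apply: mem_hull; rewrite inE.
  apply: hull_min => [_ _ t -> -> _ _|y]; last by rewrite inE => /eqP.
  by rewrite /mix /=; case: x {IH} => a b /=; congr pair; ring.
rewrite hull_cons //; apply: continuous_compact; last first.
  by apply: compact_setX => //; exact: segment_compact.
apply: continuous_subspaceT => z.
have c1 : (fun z : R * (R * R) => z.1) @ z --> z.1 by exact: cvg_fst.
have c2 : (fun z : R * (R * R) => z.2.1) @ z --> z.2.1.
  by apply: cvg_comp; [exact: cvg_snd|exact: cvg_fst].
have c3 : (fun z : R * (R * R) => z.2.2) @ z --> z.2.2.
  by apply: cvg_comp; [exact: cvg_snd|exact: cvg_snd].
apply: (@cvg_pair _ _ _ _ (nbhs _) (nbhs _) _ _ _
  (fun z => (1 - z.1) * x.1 + z.1 * z.2.1) (fun z => (1 - z.1) * x.2 + z.1 * z.2.2));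
  (apply: cvgD; apply: cvgM => //; last exact: cvg_cst);
  by apply: cvgB => //; exact: cvg_cst.
Qed.

Lemma P2o_compact P : P2o P -> compact P.
Proof. by case=> -[s ->] _; exact: hull_compact. Qed.

Lemma continuous_dotp l : continuous (dotp l).
Proof.
move=> x; apply: cvgD; apply: cvgM; try exact: cvg_cst; [exact: cvg_fst|exact: cvg_snd].
Qed.

Lemma P2o_bounded P : P2o P -> exists N, P `<=` box N.
Proof.
move=> PP; have P0 := P2o0 PP; have cP := P2o_compact PP.
have bd l : exists M, forall x, P x -> dotp l x <= M.
  have ne : P !=set0 by exists (0, 0).
  have [c _ h] := compact_EVT_max ne cP (continuous_subspaceT (@continuous_dotp l)).
  by exists (dotp l c) => x Px; apply: h; rewrite inE.
have [a ha] := bd (1, 0); have [b hb] := bd (-1, 0).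
have [c hc] := bd (0, 1); have [d hd] := bd (0, -1).
exists (`|a| + `|b| + `|c| + `|d|) => x Px.
have := (ha _ Px, hb _ Px, hc _ Px, hd _ Px); rewrite /dotp /=.
have := (ler_norm a, ler_norm b, ler_norm c, ler_norm d).
have := (normr_ge0 a, normr_ge0 b, normr_ge0 c, normr_ge0 d).
move=> [[[n1 n2] n3] n4] [[[m1 m2] m3] m4] [[[h1 h2] h3] h4].
by split; rewrite ler_norml; lra.
Qed.

Definition scale (t : R) x : R * R := (t * x.1, t * x.2).

(** The end is the maximiser of [dotp u] on the compact section of [P] by the line through 0 and
    [u]; its parameter is positive since [P] contains a box around 0. *)
Lemma ray_end P u : P2o P -> u != (0, 0) ->
  exists2 t, 0 < t & P (scale t u) /\ forall r, P (scale r u) -> r <= t.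
Proof.
move=> PP u0; have P0 := P2o0 PP; have cP := P2o_compact PP.
pose K := P `&` (dotp (- u.2, u.1)) @^-1` [set 0].
have cK : compact K.
  apply: compact_closedI => //; apply: preimage_closed; last exact: closed_eq.
  by move=> x _; exact: continuous_dotp.
have uu : 0 < u.1 * u.1 + u.2 * u.2.
  rewrite -!expr2 lt_neqAle addr_ge0 ?sqr_ge0 // andbT eq_sym paddr_eq0 ?sqr_ge0 //.
  by rewrite !sqrf_eq0 -pair_eqE /= in u0 *.
have ne : K !=set0 by exists (0, 0); split=> //; rewrite /= /dotp /=; ring.
have [c + cmax] := compact_EVT_max ne cK (continuous_subspaceT (@continuous_dotp u)).
rewrite inE => -[Pc]; rewrite /= /dotp /= => c0.
pose t := dotp u c / (u.1 * u.1 + u.2 * u.2).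
have ct : c = scale t u.
  have h1 : c.1 = t * u.1.
    rewrite /t /dotp; apply: (mulIf (lt0r_neq0 uu)); rewrite mulrAC divfK ?gt_eqF //.
    have -> : (u.1 * c.1 + u.2 * c.2) * u.1 =
        c.1 * (u.1 * u.1 + u.2 * u.2) + u.2 * (- u.2 * c.1 + u.1 * c.2) by ring.
    by rewrite c0 mulr0 addr0.
  have h2 : c.2 = t * u.2.
    rewrite /t /dotp; apply: (mulIf (lt0r_neq0 uu)); rewrite mulrAC divfK ?gt_eqF //.
    have -> : (u.1 * c.1 + u.2 * c.2) * u.2 =
        c.2 * (u.1 * u.1 + u.2 * u.2) - u.1 * (- u.2 * c.1 + u.1 * c.2) by ring.
    by rewrite c0 mulr0 subr0.
  by rewrite /scale -h1 -h2; case: (c).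
have tmax r : P (scale r u) -> r <= t.
  move=> Pr; have : dotp u (scale r u) <= dotp u c.
    by apply: cmax; rewrite inE; split=> //; rewrite /= /dotp /scale /=; ring.
  rewrite ct /dotp /scale /= => h.
  rewrite -(ler_pM2r uu); move: h; lra.
exists t; last by rewrite -ct; split.
have /nbhs0_box[e e0 eP] : nbhs (0 : R, 0 : R) P by case: PP.
have n1 := normr_ge0 u.1; have n2 := normr_ge0 u.2.
set d := `|u.1| + `|u.2| + 1.
have d0 : 0 < d by rewrite /d; lra.
have de : 0 < e / d by rewrite divr_gt0.
apply: (lt_le_trans de); apply: tmax; apply: eP; rewrite /scale /= normrM (gtr0_norm de);
by rewrite mulrAC ltr_pdivrMr // ltr_pM2l // /d; lra.
Qed.

End Polygons.

(** * Cutting along a chord through the origin *)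

Section Sectors.
Variable R : realType.
Implicit Types (x y l a b c v w : R * R) (P : set (R * R)) (s t p q r : R).

Lemma dotp_scale l t x : dotp l (scale t x) = t * dotp l x.
Proof. by rewrite /dotp /scale /=; ring. Qed.

Lemma dotp_mix l t x y : dotp l (mix t x y) = (1 - t) * dotp l x + t * dotp l y.
Proof. by rewrite /dotp /mix /=; ring. Qed.

Definition comb p a q b : R * R := (p * a.1 + q * b.1, p * a.2 + q * b.2).

Lemma dotp_comb l p a q b : dotp l (comb p a q b) = p * dotp l a + q * dotp l b.
Proof. by rewrite /dotp /comb /=; ring. Qed.

Lemma comb_dotp x p a q b : dotp (comb p a q b) x = p * dotp a x + q * dotp b x.
Proof. by rewrite /dotp /comb /=; ring. Qed.

(** The conditions make [l] and [g] linearly independent, hence coordinates on the plane. *)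
Lemma dotp_inj l g a v x y : dotp l a = 1 -> dotp g a = 0 -> dotp g v != 0 ->
  dotp l x = dotp l y -> dotp g x = dotp g y -> x = y.
Proof.
move=> la ga gv lxy gxy.
have D : l.1 * g.2 - l.2 * g.1 != 0.
  apply/eqP => D0; move/eqP: gv; apply.
  have : (l.1 * g.2 - l.2 * g.1) * (a.1 * v.2 - a.2 * v.1) =
     dotp l a * dotp g v - dotp l v * dotp g a by rewrite /dotp; ring.
  by rewrite D0 mul0r la ga mul1r mulr0 subr0.
have e1 : (l.1 * g.2 - l.2 * g.1) * (x.1 - y.1) =
   g.2 * (dotp l x - dotp l y) - l.2 * (dotp g x - dotp g y) by rewrite /dotp; ring.
have e2 : (l.1 * g.2 - l.2 * g.1) * (x.2 - y.2) =
   l.1 * (dotp g x - dotp g y) - g.1 * (dotp l x - dotp l y) by rewrite /dotp; ring.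
move: e1 e2; rewrite lxy gxy !subrr !mulr0 subrr => /eqP + /eqP.
rewrite !mulf_eq0 (negbTE D) /= !subr_eq0 => /eqP e1 /eqP e2.
by rewrite (surjective_pairing x) e1 e2 -surjective_pairing.
Qed.

Lemma convex_cone2 P x y p q : is_convex P -> P (0, 0) -> P x -> P y ->
  0 <= p -> 0 <= q -> p + q <= 1 -> P (comb p x q y).
Proof.
move=> cP P0 Px Py p0 q0 pq.
have := p0; rewrite le_eqVlt => /orP[/eqP pp|pp].
  rewrite (_ : comb p x q y = mix q (0, 0) y); last first.
    by rewrite /comb /mix /= -pp; congr pair; ring.
  by apply: cP => //; lra.
have pq0 : 0 < p + q by lra.
rewrite (_ : comb p x q y = mix (p + q) (0, 0) (mix (q / (p + q)) x y)); last first.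
  by rewrite /comb /mix /=; congr pair; field; rewrite gt_eqF.
apply: (cP) => //; try lra; apply: (cP) => //; first by rewrite divr_ge0 // ltW.
by rewrite ler_pdivrMr // mul1r; lra.
Qed.

(* [l1], [l2], [l3], [l4] are the sides of the quadrilateral with vertices
   [a], [v], [- a / s], [w]; its diagonal from [a] to [- a / s] passes through 0. *)
Definition quad_sides a s g v w l1 l2 l3 l4 :=
  [/\ 0 < s, [/\ dotp g a = 0, 0 < dotp g v & dotp g w < 0],
    dotp l1 a = 1 /\ dotp l1 v = 1, dotp l2 a = - s /\ dotp l2 v = 1 &
    (dotp l3 a = 1 /\ dotp l3 w = 1) /\ (dotp l4 a = - s /\ dotp l4 w = 1)].

(** The segments from 0 to the vertices split the quadrilateral into four triangles with a corner at
    0; the signs of the coordinates of [x] select one of them, and convexity of [P] covers it. *)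
Lemma quad_sub P a s g v w l1 l2 l3 l4 : quad_sides a s g v w l1 l2 l3 l4 ->
  is_convex P -> P (0, 0) -> P a -> P (scale (- s^-1) a) -> P v -> P w ->
  cuts [:: l1; l2; l3; l4] `<=` P.
Proof.
move=> [s0 [ga gv gw] [h1a h1v] [h2a h2v] [[h3a h3w] [h4a h4w]]].
move=> cP P0 Pa Pa' Pv Pw x; rewrite /cuts /= => /and5P[x1 x2 x3 x4 _].
have half u k1 k2 : dotp g u != 0 -> 0 <= dotp g x / dotp g u -> P u ->
    dotp k1 a = 1 -> dotp k1 u = 1 -> dotp k2 a = - s -> dotp k2 u = 1 ->
    dotp k1 x <= 1 -> dotp k2 x <= 1 -> P x.
  move=> gu; set t := _ / _ => t0 Pu k1a k1u k2a k2u k1x k2x.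
  pose z := dotp k1 x - t.
  have xE : x = comb t u z a.
    apply: (@dotp_inj k1 g a u) => //; rewrite dotp_comb ?k1a ?k1u ?ga /z; first by ring.
    by rewrite mulr0 addr0 /t divfK.
  have : dotp k2 x = t - s * z by rewrite xE dotp_comb k2a k2u; ring.
  case: (leP 0 z) => z0 k2xE.
    by rewrite xE; apply: convex_cone2 => //; rewrite /z; lra.
  rewrite xE (_ : comb t u z a = comb t u (- s * z) (scale (- s^-1) a)); last first.
    by rewrite /comb /scale /=; congr pair; field; rewrite gt_eqF.
  apply: convex_cone2 => //; last by lra.
  by rewrite mulNr -mulrN mulr_ge0 ?ltW // oppr_gt0.
case: (leP 0 (dotp g x)) => gx.
  apply: (half v l1 l2) => //; first by rewrite gt_eqF.
  by rewrite divr_ge0 // ltW.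
apply: (half w l3 l4) => //; first by rewrite lt_eqF.
by rewrite -mulrNN mulr_ge0 ?oppr_ge0 ?invr_le0 ?ltW.
Qed.

(** Otherwise the segment from [x] to [v] would meet the line of [a] at a point of [P] beyond the
    bound [1 / r]. So the line through [v] and [a / r], once extended, has the whole opposite half
    of [P] on its inner side. *)
Lemma convex_opposite_side P a v g l r : is_convex P -> P v -> dotp g a = 0 ->
  0 < dotp g v -> dotp l v = 1 -> 0 < r -> dotp l a = r ->
  (forall t, P (scale t a) -> r * t <= 1) ->
  forall x, P x -> dotp g x <= 0 -> dotp l x <= 1.
Proof.
move=> cP Pv ga gv lv r0 la aP x Px gx; rewrite leNgt; apply/negP => lx.
have D : 0 < dotp g v - dotp g x by lra.
pose t := - dotp g x / (dotp g v - dotp g x).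
have t0 : 0 <= t by rewrite divr_ge0 ?oppr_ge0 // ltW.
have t1 : t < 1 by rewrite ltr_pdivrMr // mul1r; lra.
pose y := mix t x v.
have Py : P y by apply: cP => //; exact: ltW.
have gy : dotp g y = 0 by rewrite dotp_mix /t; field; rewrite gt_eqF.
have ly : 1 < dotp l y.
  rewrite dotp_mix lv; have : 0 < (1 - t) * (dotp l x - 1) by rewrite mulr_gt0 // subr_gt0.
  lra.
have yE : y = scale (dotp l y / r) a.
  apply: (@dotp_inj (scale r^-1 l) g a v); rewrite ?gt_eqF //.
  - by rewrite /dotp /scale /= -!mulrA -mulrDr -/(dotp l a) la mulVf // gt_eqF.
  - rewrite dotp_scale (_ : dotp (scale _ _) a = 1) ?mulr1.
      by rewrite /dotp /scale /=; ring.
    by rewrite /dotp /scale /= -!mulrA -mulrDr -/(dotp l a) la mulVf // gt_eqF.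
  - by rewrite dotp_scale ga mulr0.
move: Py; rewrite yE => /aP; rewrite mulrC divfK ?gt_eqF //; lra.
Qed.

Lemma valuation_cuts (mu : set (R * R) -> 'M[R]_2) P ls ls' : valuation_P2o mu -> P2o P ->
  (forall x, P x -> cuts ls x \/ cuts ls' x) ->
  mu P + mu (P `&` cuts (ls ++ ls')) = mu (P `&` cuts ls) + mu (P `&` cuts ls').
Proof.
move=> vmu PP h.
have E1 : P = (P `&` cuts ls) `|` (P `&` cuts ls').
  by apply/seteqP; split=> [x Px|x [[]|[]]] //; case: (h _ Px) => ?; [left|right].
have E2 : P `&` cuts (ls ++ ls') = (P `&` cuts ls) `&` (P `&` cuts ls').
  apply/seteqP; split=> x; rewrite /cuts /= all_cat.
    by move=> [Px /andP[]].
  by move=> [[Px ?] [_ ?]]; split => //; apply/andP.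
have := vmu _ _ (P2o_cuts ls PP) (P2o_cuts ls' PP); rewrite -E1 -E2.
by apply => //; exact: P2o_cuts.
Qed.

Variable nu : set (R * R) -> 'M[R]_2.
Hypothesis nuval : valuation_P2o nu.
(** The two inequalities put [v] on the inner side of the sides at [w], so that the four lines bound
    a convex quadrilateral with these vertices, possibly flat at [a] or [- a / s]. [quad_eq0]
    establishes the property. *)
Hypothesis nuquad : forall a s g v w l1 l2 l3 l4,
  quad_sides a s g v w l1 l2 l3 l4 -> dotp l3 v <= 1 -> dotp l4 v <= 1 ->
  nu (cuts [:: l1; l2; l3; l4]) = 0.

(** Each clipping replaces one half of [P] by the triangle on the chord with apex [v] or [w] and, by
    [convex_opposite_side], leaves the other half intact. Their union is [P], and their intersection
    is a quadrilateral on which [nu] vanishes. *)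
Lemma cut_chord P a s g v w l1 l2 l3 l4 : quad_sides a s g v w l1 l2 l3 l4 ->
  P2o P -> P a -> P (scale (- s^-1) a) -> P v -> P w ->
  (forall t, P (scale t a) -> t <= 1 /\ - s * t <= 1) ->
  nu P = nu (P `&` cuts [:: l1; l2]) + nu (P `&` cuts [:: l3; l4]).
Proof.
move=> qs PP Pa Pa' Pv Pw aP; have cP := P2o_convex PP.
have [s0 [ga gv gw] [h1a h1v] [h2a h2v] [[h3a h3w] [h4a h4w]]] := qs.
have ga' : dotp g (scale (-1) a) = 0 by rewrite dotp_scale ga mulr0.
have aP1 t : P (scale t a) -> 1 * t <= 1 by move=> /aP[]; rewrite mul1r.
have aP2 t : P (scale t (scale (-1) a)) -> s * t <= 1.
  rewrite (_ : scale t _ = scale (- t) a); first by move=> /aP[_]; rewrite mulrNN.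
  by rewrite /scale /=; congr pair; ring.
have k2 : dotp l2 (scale (-1) a) = s by rewrite dotp_scale h2a mulrNN mul1r.
have k4 : dotp l4 (scale (-1) a) = s by rewrite dotp_scale h4a mulrNN mul1r.
have ng y : dotp (scale (-1) g) y = - dotp g y by rewrite /dotp /scale /=; ring.
have nga : dotp (scale (-1) g) a = 0 by rewrite ng ga oppr0.
have nga' : dotp (scale (-1) g) (scale (-1) a) = 0 by rewrite ng ga' oppr0.
have ngw : 0 < dotp (scale (-1) g) w by rewrite ng oppr_gt0.
have H1 := convex_opposite_side cP Pv ga gv h1v ltr01 h1a aP1.
have H2 := convex_opposite_side cP Pv ga' gv h2v s0 k2 aP2.
have H3 := convex_opposite_side cP Pw nga ngw h3w ltr01 h3a aP1.
have H4 := convex_opposite_side cP Pw nga' ngw h4w s0 k4 aP2.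
have ngv : dotp (scale (-1) g) v <= 0 by rewrite ng oppr_le0 ltW.
have Q0 := nuquad qs (H3 v Pv ngv) (H4 v Pv ngv).
have := quad_sub qs cP (P2o0 PP) Pa Pa' Pv Pw.
rewrite -valuation_cuts //=.
  by move=> /setIidPr => h; rewrite h Q0 addr0.
move=> x Px; case: (leP (dotp g x) 0) => gx; [left|right];
  rewrite /cuts /= andbT; apply/andP; split.
- exact: H1.
- exact: H2.
- by apply: H3 => //; rewrite ng oppr_le0 ltW.
- by apply: H4 => //; rewrite ng oppr_le0 ltW.
Qed.

(** Both sides are [nu P] minus the same term: the value does not depend on the apex that completes
    the kept half. *)
Lemma cut_chord_indep P a s g v w w' l1 l2 l3 l4 l3' l4' :
  quad_sides a s g v w l1 l2 l3 l4 -> quad_sides a s g v w' l1 l2 l3' l4' ->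
  P2o P -> P a -> P (scale (- s^-1) a) -> P v -> P w -> P w' ->
  (forall t, P (scale t a) -> t <= 1 /\ - s * t <= 1) ->
  nu (P `&` cuts [:: l3; l4]) = nu (P `&` cuts [:: l3'; l4']).
Proof.
move=> qs qs' PP Pa Pa' Pv Pw Pw' aP.
have := cut_chord qs PP Pa Pa' Pv Pw aP.
by rewrite (cut_chord qs' PP Pa Pa' Pv Pw' aP) => /addrI.
Qed.

End Sectors.

(** * Reduction to quadrilaterals with a diagonal through the origin *)

Section SectorInduction.
Variable R : realType.
Implicit Types (x y l a b c v w al be : R * R) (P : set (R * R)) (s t r : R).

Definition dual_basis al be a b :=
  [/\ dotp al a = 1, dotp be a = 0, dotp al b = 0 & dotp be b = 1].

Lemma dual_basisC al be a b : dual_basis al be a b -> dual_basis be al b a.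
Proof. by case. Qed.

Lemma dual_basisE al be a b x : dual_basis al be a b ->
  x = comb (dotp al x) a (dotp be x) b.
Proof.
move=> [aa ba ab bb]; apply: (@dotp_inj R al be a b) => //.
- by rewrite bb oner_eq0.
- by rewrite dotp_comb aa ab; ring.
- by rewrite dotp_comb ba bb; ring.
Qed.

Lemma combC p a q b : comb p a q b = comb q b p a :> R * R.
Proof. by rewrite /comb; congr pair; rewrite addrC. Qed.

Definition boundary_pt P a := P a /\ forall t, P (scale t a) -> t <= 1.

(** [comb 1 al (- t) be] is the line through [a] and [- b / t]; this is [convex_opposite_side] for
    it, with [be] reversed. *)
Lemma boundary_sector P al be a b t : is_convex P -> dual_basis al be a b ->
  boundary_pt P a -> 0 < t -> P (scale (- t^-1) b) ->
  forall x, P x -> 0 <= dotp be x -> dotp al x - t * dotp be x <= 1.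
Proof.
move=> cP [aa ba ab bb] [_ aP] t0 Pb x Px bx.
have tt : t * t^-1 = 1 by rewrite divff // gt_eqF.
have -> : dotp al x - t * dotp be x = dotp (comb 1 al (- t) be) x.
  by rewrite comb_dotp; ring.
apply: (@convex_opposite_side R P a (scale (- t^-1) b) (comb 0 al (-1) be) _ 1) => //.
- by rewrite comb_dotp ba; ring.
- by rewrite comb_dotp !dotp_scale bb; have := t0; rewrite -invr_gt0; lra.
- by rewrite comb_dotp !dotp_scale ab bb; lra.
- by rewrite comb_dotp aa ba; ring.
- by move=> r /aP; rewrite mul1r.
- by rewrite comb_dotp; lra.
Qed.

(** A point beyond the line through [a] and [b] forces a generator beyond it. That generator is
    outside the open cone, so the segment joining it to the point meets one of the two rays beyond
    [a] or [b]. *)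
Lemma hull_sector_triangle (gens : seq (R * R)) al be a b : dual_basis al be a b ->
  boundary_pt (conv_hull gens) a -> boundary_pt (conv_hull gens) b ->
  (forall g, g \in gens -> ~ (0 < dotp al g /\ 0 < dotp be g)) ->
  forall x, conv_hull gens x -> 0 <= dotp al x -> 0 <= dotp be x ->
  dotp al x + dotp be x <= 1.
Proof.
move=> fr ba bb sg x Px ax bx; rewrite leNgt; apply/negP => abx.
have [g gs gab] : exists2 g, g \in gens & 1 < dotp al g + dotp be g.
  apply: contrapT => ng.
  have : conv_hull gens `<=` halfplane (comb 1 al 1 be).
    apply: hull_min; first exact: halfplane_convex.
    move=> g gs; rewrite /halfplane /= comb_dotp !mul1r leNgt; apply/negP => h.
    by apply: ng; exists g.
  by move=> /(_ x Px); rewrite /halfplane /= comb_dotp !mul1r leNgt abx.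
have Pg := mem_hull gs.
(* Stated for an arbitrary dual basis so as to serve both rays. *)
have cross (al' be' a' b' : R * R) : dual_basis al' be' a' b' ->
    boundary_pt (conv_hull gens) a' -> dotp be' g <= 0 -> 0 <= dotp be' x ->
    1 < dotp al' g + dotp be' g -> 1 < dotp al' x + dotp be' x -> False.
  move=> fr' [_ aP] g0 x0 g1 x1.
  have := x0; rewrite le_eqVlt => /orP[/eqP xe|xp].
    move: Px; rewrite (dual_basisE x fr') -xe.
    rewrite (_ : comb _ _ _ _ = scale (dotp al' x) a'); first by move=> /aP; lra.
    by rewrite /comb /scale; congr pair; ring.
  have D : 0 < dotp be' x - dotp be' g by lra.
  pose t := dotp be' x / (dotp be' x - dotp be' g).
  have t0 : 0 <= t by rewrite divr_ge0 // ltW.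
  have t1 : t <= 1 by rewrite ler_pdivrMr // mul1r; lra.
  have := hull_convex Px Pg t0 t1; rewrite (dual_basisE (mix t x g) fr').
  have -> : dotp be' (mix t x g) = 0 by rewrite dotp_mix /t; field; rewrite gt_eqF.
  rewrite (_ : comb _ _ _ _ = scale (dotp al' (mix t x g)) a'); last first.
    by rewrite /comb /scale; congr pair; ring.
  move=> /aP; rewrite leNgt => /negP; apply.
  have : dotp be' (mix t x g) = 0 by rewrite dotp_mix /t; field; rewrite gt_eqF.
  rewrite !dotp_mix.
  have : 0 <= (1 - t) * (dotp al' x + dotp be' x - 1) by rewrite mulr_ge0; lra.
  have : 0 <= t * (dotp al' g + dotp be' g - 1) by rewrite mulr_ge0; lra.
  have := t0; rewrite le_eqVlt => /orP[/eqP te|tp].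
    have : 0 < (1 - t) * (dotp al' x + dotp be' x - 1) by rewrite mulr_gt0; lra.
    lra.
  have : 0 < t * (dotp al' g + dotp be' g - 1) by rewrite mulr_gt0; lra.
  lra.
case: (leP (dotp be g) 0) => gb; first exact: (cross al be a b).
case: (leP (dotp al g) 0) => ga; last exact: (sg g gs).
by apply: (cross be al b a) => //; [exact: dual_basisC|lra|lra].
Qed.

Lemma opposite_pt P u : P2o P -> u != (0, 0) ->
  exists2 t, 0 < t & P (scale (- t^-1) u).
Proof.
move=> PP u0; have [|t t0 [Pt _]] := @ray_end R P (scale (-1) u) PP.
  by apply: contra u0; rewrite -!pair_eqE /= /pair_eq /= !mulN1r !oppr_eq0.
exists t^-1; rewrite ?invr_gt0 // invrK.
by rewrite (_ : scale _ _ = scale t (scale (-1) u)) // /scale /=; congr pair; ring.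
Qed.

Lemma boundary_pt_on_ray P u : P2o P -> u != (0, 0) ->
  exists2 t, 0 < t & boundary_pt P (scale t u).
Proof.
move=> PP u0; have [t t0 [Pt tP]] := ray_end PP u0; exists t => //; split=> // r.
rewrite (_ : scale r _ = scale (r * t) u); last by rewrite /scale /=; congr pair; ring.
by move=> /tP; rewrite ger_pMl.
Qed.

Lemma ltn_count (T : Type) (p q : pred T) (xs : seq T) :
  subpred p q -> has (predD q p) xs -> (count p xs < count q xs)%N.
Proof.
move=> pq; elim: xs => //= x xs IH /orP[/andP[/negbTE -> ->]|/IH h].
  by rewrite add0n add1n ltnS; exact: sub_count.
rewrite -addnS leq_add //; case px : (p x) => //=.
by rewrite (pq _ px).
Qed.

Variable nu : set (R * R) -> 'M[R]_2.
Hypothesis nuval : valuation_P2o nu.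
Hypothesis nuquad : forall a s g v w l1 l2 l3 l4,
  quad_sides a s g v w l1 l2 l3 l4 -> dotp l3 v <= 1 -> dotp l4 v <= 1 ->
  nu (cuts [:: l1; l2; l3; l4]) = 0.

(* The part of [P] in the cone spanned by [a] and [b], completed by the points
   [- a / s] and [- b / t]; here [al], [be] is the basis dual to [a], [b]. *)
Definition sector P al be s t := P `&`
  cuts [:: comb 1 al (- t) be; comb (- s) al 1 be; comb (- s) al (- t) be].

(** The clipped set is the sector between [a] and [c], except that it is completed by [- b / t]
    instead of [- c / t1]. [cut_chord_indep], along the chord from [a] to [- a / s] with apex [c] on
    the kept side, exchanges the two. *)
Lemma half_sector P al be a b c s t t1 : P2o P -> dual_basis al be a b ->
  boundary_pt P a -> boundary_pt P b -> boundary_pt P c ->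
  0 < dotp al c -> 0 < dotp be c -> 0 < s -> 0 < t -> 0 < t1 ->
  P (scale (- s^-1) a) -> P (scale (- t^-1) b) -> P (scale (- t1^-1) c) ->
  let al1 := comb 1 al (- (dotp al c / dotp be c)) be in
  let be1 := comb 0 al (dotp be c)^-1 be in
  nu (sector P al be s t `&`
    cuts [:: comb (- s) al1 1 be1; comb (- s) al (- t) be]) =
  nu (sector P al1 be1 s t1).
Proof.
move=> PP fr [Pa aP] bb [Pc cbd] c1 c2 s0 t0 t10 Pa' Pb' Pc' al1 be1.
have [aa ba ab bbe] := fr.
have cP := P2o_convex PP.
have tt : t * t^-1 = 1 by rewrite divff // gt_eqF.
have ss : s * s^-1 = 1 by rewrite divff // gt_eqF.
have tt1 : t1 * t1^-1 = 1 by rewrite divff // gt_eqF.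
have cc : dotp be c * (dotp be c)^-1 = 1 by rewrite divff // gt_eqF.
have a1a : dotp al1 a = 1 by rewrite comb_dotp aa ba; ring.
have a1c : dotp al1 c = 0 by rewrite comb_dotp; field; rewrite gt_eqF.
have b1a : dotp be1 a = 0 by rewrite comb_dotp aa ba; ring.
have b1c : dotp be1 c = 1 by rewrite comb_dotp mul0r add0r mulrC.
pose lc := comb (- s) al1 1 be1.
have lcE x : dotp lc x = - s * dotp al x +
    (1 + s * dotp al c) / dotp be c * dotp be x.
  by rewrite /lc !comb_dotp; field; rewrite gt_eqF.
(* [c] lies within the line through [b] and [- a / s], so the line from [- a / s] through [c] cuts
   at least as deep where [be] is nonnegative. *)
have m1 : 1 <= (1 + s * dotp al c) / dotp be c.
  rewrite ler_pdivlMr // mul1r.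
  have := boundary_sector cP (dual_basisC fr) bb s0 Pa' Pc (ltW c1); lra.
have s0' : 0 < s^-1 by rewrite invr_gt0.
have t0' : 0 < t^-1 by rewrite invr_gt0.
have t10' : 0 < t1^-1 by rewrite invr_gt0.
have lca' : dotp lc (scale (- s^-1) a) = 1.
  by rewrite dotp_scale comb_dotp a1a b1a; lra.
clearbody al1 be1.
have -> : sector P al be s t `&` cuts [:: lc; comb (- s) al (- t) be] =
    (P `&` cuts [:: lc]) `&` cuts [:: comb 1 al (- t) be; comb (- s) al (- t) be].
  apply/seteqP; split=> x; rewrite /sector /cuts /= ?andbT.
    by move=> [[Px /and3P[h1 h2 h3]] /andP[h4 _]]; rewrite h1 h3 h4.
  move=> [[Px h1] /andP[h2 h3]]; rewrite h1 h2 h3 !andbT; do 2!split => //.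
  move: h1 h2 h3; rewrite lcE !comb_dotp => h1 h2 h3.
  case: (leP 0 (dotp be x)) => bx.
    have : 0 <= ((1 + s * dotp al c) / dotp be c - 1) * dotp be x.
      by rewrite mulr_ge0 // subr_ge0.
    lra.
  have : 0 < t * - dotp be x by rewrite mulr_gt0 // oppr_gt0.
  lra.
rewrite (@cut_chord_indep R nu nuval nuquad _ a s be c (scale (- t^-1) b)
   (scale (- t1^-1) c) (comb 1 al1 1 be1) lc _ _
   (comb 1 al1 (- t1) be1) (comb (- s) al1 (- t1) be1)).
- congr nu; rewrite /sector /cuts; apply/seteqP; split=> x /=; rewrite ?andbT.
    by move=> [[Px ->] /andP[-> ->]].
  by move=> [Px /and3P[-> -> ->]].
- split=> //; rewrite ?dotp_scale ?comb_dotp ?dotp_scale ?aa ?ba ?ab ?bbe ?a1a ?a1c ?b1a ?b1c;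
    do ?split=> //; lra.
- split=> //; rewrite ?dotp_scale ?comb_dotp ?dotp_scale ?aa ?ba ?ab ?bbe ?a1a ?a1c ?b1a ?b1c;
    do ?split=> //; rewrite ?pmulr_llt0 ?oppr_lt0 //; lra.
- exact: P2o_cuts.
- by split=> //; rewrite /cuts /= andbT comb_dotp a1a b1a; lra.
- by split=> //; rewrite /cuts /= andbT lca'.
- by split=> //; rewrite /cuts /= andbT comb_dotp a1c b1c; lra.
- split=> //; rewrite /cuts /= andbT lcE !dotp_scale ab bbe.
  have : 0 <= ((1 + s * dotp al c) / dotp be c) * t^-1 by rewrite mulr_ge0; lra.
  lra.
- by split=> //; rewrite /cuts /= andbT comb_dotp !dotp_scale a1c b1c; lra.
- move=> r [/aP r1]; rewrite /cuts /= andbT comb_dotp !dotp_scale a1a b1a; lra.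
Qed.

(** [hull_sector_triangle] identifies the sector with the quadrilateral of vertices [a], [b],
    [- a / s], [- b / t]. *)
Lemma sector_eq0_base (gens : seq (R * R)) al be a b s t :
  let P := conv_hull gens in P2o P -> dual_basis al be a b ->
  boundary_pt P a -> boundary_pt P b -> 0 < s -> 0 < t ->
  P (scale (- s^-1) a) -> P (scale (- t^-1) b) ->
  (forall g, g \in gens -> ~ (0 < dotp al g /\ 0 < dotp be g)) ->
  nu (sector P al be s t) = 0.
Proof.
move=> P PP fr bda bdb s0 t0 Pa' Pb' ng; have cP := P2o_convex PP.
have [aa ba ab bb] := fr; have [Pa aP] := bda; have [Pb bP] := bdb.
have tt : t * t^-1 = 1 by rewrite divff // gt_eqF.
have ss : s * s^-1 = 1 by rewrite divff // gt_eqF.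
have s0' : 0 < s^-1 by rewrite invr_gt0.
have t0' : 0 < t^-1 by rewrite invr_gt0.
have qs : quad_sides a s be b (scale (- t^-1) b) (comb 1 al 1 be)
    (comb (- s) al 1 be) (comb 1 al (- t) be) (comb (- s) al (- t) be).
  split=> //; rewrite ?dotp_scale ?comb_dotp ?dotp_scale ?aa ?ba ?ab ?bb;
    do ?split=> //; lra.
rewrite -(nuquad qs); last 2 first.
- by rewrite comb_dotp ab bb; lra.
- by rewrite comb_dotp ab bb; lra.
congr nu; apply/seteqP; split=> x; last first.
  move=> xc; split; first exact: (quad_sub qs cP (P2o0 PP)).
  by move: xc; rewrite /cuts /= => /and5P[_ -> -> ->].
rewrite /sector /cuts /=; move=> [Px /and4P[h1 h2 h3 _]].
rewrite h1 h2 h3 !andbT; move: h1 h2 h3; rewrite !comb_dotp => h1 h2 h3.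
case: (leP 0 (dotp be x)) => bx; last first.
  have : 0 < t * - dotp be x by rewrite mulr_gt0 // oppr_gt0.
  lra.
case: (leP 0 (dotp al x)) => ax; last first.
  have : 0 < s * - dotp al x by rewrite mulr_gt0 // oppr_gt0.
  lra.
have := hull_sector_triangle fr bda bdb ng Px ax bx; lra.
Qed.

(** Induction on a bound for the number of generators strictly inside the cone. A cut along the ray
    through such a generator leaves two sectors, each with fewer of them because this generator
    moves to their common boundary ray. *)
Lemma sector_eq0 (gens : seq (R * R)) n al be a b s t :
  let P := conv_hull gens in P2o P -> dual_basis al be a b ->
  boundary_pt P a -> boundary_pt P b -> 0 < s -> 0 < t ->
  P (scale (- s^-1) a) -> P (scale (- t^-1) b) ->
  (count (fun g => (0 < dotp al g)%R && (0 < dotp be g)%R) gens <= n)%N ->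
  nu (sector P al be s t) = 0.
Proof.
move=> P PP; have cP := P2o_convex PP.
elim: n al be a b s t => [|n IH] al be a b s t fr bda bdb s0 t0 Pa' Pb' cnt.
  apply: (sector_eq0_base PP fr) => // g gs [h1 h2].
  have : has (fun g => (0 < dotp al g)%R && (0 < dotp be g)%R) gens.
    by apply/hasP; exists g; rewrite // h1 h2.
  by rewrite has_count ltnNge cnt.
case: (pselect (exists2 g, g \in gens & 0 < dotp al g /\ 0 < dotp be g)); last first.
  by move=> h; apply: (sector_eq0_base PP fr) => // g gs gab; apply: h; exists g.
move=> [g gs [ga gb]].
have [aa ba ab bb] := fr; have [Pa aP] := bda; have [Pb bP] := bdb.
have g0 : g != (0, 0).
  by apply/eqP => g0; move: ga; rewrite g0 /dotp /= !mulr0 addr0 ltxx.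
have [r r0 bdc] := boundary_pt_on_ray PP g0.
set c := scale r g in bdc; have [Pc cbd] := bdc.
have c1 : 0 < dotp al c by rewrite dotp_scale mulr_gt0.
have c2 : 0 < dotp be c by rewrite dotp_scale mulr_gt0.
have c0 : c != (0, 0).
  by apply/eqP => c0; move: c1; rewrite c0 /dotp /= !mulr0 addr0 ltxx.
have [t1 t10 Pc'] := opposite_pt PP c0.
have tt : t * t^-1 = 1 by rewrite divff // gt_eqF.
have ss : s * s^-1 = 1 by rewrite divff // gt_eqF.
have s0' : 0 < s^-1 by rewrite invr_gt0.
have t0' : 0 < t^-1 by rewrite invr_gt0.
pose al1 := comb 1 al (- (dotp al c / dotp be c)) be.
pose be1 := comb 0 al (dotp be c)^-1 be.
pose al2 := comb 1 be (- (dotp be c / dotp al c)) al.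
pose be2 := comb 0 be (dotp al c)^-1 al.
have fr1 : dual_basis al1 be1 a c.
  by split; rewrite comb_dotp ?aa ?ba; try field; rewrite ?gt_eqF //; ring.
have fr2 : dual_basis al2 be2 b c.
  by split; rewrite comb_dotp ?ab ?bb; try field; rewrite ?gt_eqF //; ring.
have lt_cnt (u v : R * R) : (forall x, 0 < dotp u x -> 0 < dotp v x ->
      0 < dotp al x /\ 0 < dotp be x) -> dotp u g = 0 ->
    (count (fun g => (0 < dotp u g)%R && (0 < dotp v g)%R) gens <= n)%N.
  move=> h ug; rewrite -ltnS; apply: leq_trans cnt; apply: ltn_count.
    by move=> x /andP[h1 h2]; have [-> ->] := h _ h1 h2.
  by apply/hasP; exists g => //=; rewrite ug ltxx ga gb.
have z1 : nu (sector P al1 be1 s t1) = 0.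
  apply: (IH _ _ a c) => //; apply: lt_cnt.
    move=> x; rewrite !comb_dotp mul0r add0r mul1r => h1 h2.
    have bx : 0 < dotp be x by move: h2; rewrite pmulr_rgt0 // invr_gt0.
    split=> //; have : 0 < dotp al c / dotp be c * dotp be x.
      by rewrite mulr_gt0 // divr_gt0.
    lra.
  have : dotp al1 c = 0 by case: fr1.
  by rewrite dotp_scale => /eqP; rewrite mulf_eq0 gt_eqF //= => /eqP.
have z2 : nu (sector P al2 be2 t t1) = 0.
  apply: (IH _ _ b c) => //; apply: lt_cnt.
    move=> x; rewrite !comb_dotp mul0r add0r mul1r => h1 h2.
    have ax : 0 < dotp al x by move: h2; rewrite pmulr_rgt0 // invr_gt0.
    split=> //; have : 0 < dotp be c / dotp al c * dotp al x.
      by rewrite mulr_gt0 // divr_gt0.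
    lra.
  have : dotp al2 c = 0 by case: fr2.
  by rewrite dotp_scale => /eqP; rewrite mulf_eq0 gt_eqF //= => /eqP.
have e1 := half_sector PP fr bda bdb bdc c1 c2 s0 t0 t10 Pa' Pb' Pc'.
have e2 := half_sector PP (dual_basisC fr) bdb bda bdc c2 c1 t0 s0 t10 Pb' Pa' Pc'.
rewrite /= -/al1 -/be1 z1 in e1; rewrite /= -/al2 -/be2 z2 in e2.
have sC : sector P be al t s = sector P al be s t.
  rewrite /sector (combC 1 be) (combC (- t) be 1) (combC (- t) be (- s)).
  by apply/seteqP; split=> x [Px]; rewrite /cuts /= => /and4P[h1 h2 h3 _];
    rewrite h1 h2 h3.
rewrite sC in e2.
(* Chosen so that [- c / k] lies on the segment from [- a / s] to [- b / t], which bounds the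
   sector. *)
pose k := s * dotp al c + t * dotp be c.
have sc0 : 0 < s * dotp al c by rewrite mulr_gt0.
have tc0 : 0 < t * dotp be c by rewrite mulr_gt0.
have k0 : 0 < k by rewrite addr_gt0.
have kk : k * k^-1 = 1 by rewrite divff // gt_eqF.
have k0' : 0 < k^-1 by rewrite invr_gt0.
have PS : P2o (sector P al be s t) by exact: P2o_cuts.
have fc1 : dotp al1 c = 0 by case: fr1.
have fa1 : dotp al1 a = 1 by case: fr1.
have gc1 : dotp be1 c = 1 by case: fr1.
have ga1 : dotp be1 a = 0 by case: fr1.
have fc2 : dotp al2 c = 0 by case: fr2.
have fb2 : dotp al2 b = 1 by case: fr2.
have gc2 : dotp be2 c = 1 by case: fr2.
have gb2 : dotp be2 b = 0 by case: fr2.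
have al1b : dotp al1 b < 0.
  by rewrite comb_dotp ab bb mulr0 add0r mulr1 oppr_lt0 divr_gt0.
clearbody al1 be1 al2 be2 c.
(* The cut runs along the chord from [c] to [- c / k]. The quadrilateral lost is the triangle [c],
   [- a / s], [- b / t], so its second and fourth sides are on the same line. *)
rewrite (@cut_chord R nu nuval nuquad _ c k al1 (scale (- t^-1) b) (scale (- s^-1) a)
  (comb (- t) al2 1 be2) (comb (- t) be (- s) al)
  (comb (- s) al1 1 be1) (comb (- s) al (- t) be) _ PS).
- by rewrite e1 e2 addr0.
- split=> //.
  + split=> //; last by rewrite dotp_scale fa1; lra.
    by rewrite dotp_scale mulNr oppr_gt0 pmulr_rlt0.
  + by split; rewrite !(comb_dotp, dotp_scale, fc2, gc2, fb2, gb2); lra.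
  + by split; rewrite !(comb_dotp, dotp_scale, ab, bb) /k; lra.
  + split; split; rewrite !(comb_dotp, dotp_scale, fc1, gc1, fa1, ga1, aa, ba) /k; lra.
- split=> //; rewrite /cuts /= !comb_dotp.
  have h1 := boundary_sector cP fr bda t0 Pb' Pc (ltW c2).
  have h2 := boundary_sector cP (dual_basisC fr) bdb s0 Pa' Pc (ltW c1).
  by rewrite andbT; apply/and3P; split; lra.
- have kc : k^-1 * (s * dotp al c + t * dotp be c) = 1 by rewrite mulrC.
  have a0 : 0 < k^-1 * (s * dotp al c) by rewrite mulr_gt0.
  have b0 : 0 < k^-1 * (t * dotp be c) by rewrite mulr_gt0.
  have a1 : 0 < k^-1 * dotp al c by rewrite mulr_gt0.
  have b1 : 0 < k^-1 * dotp be c by rewrite mulr_gt0.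
  split; last first.
    by rewrite /cuts /= !comb_dotp !dotp_scale andbT; apply/and3P; split; lra.
  rewrite (_ : scale _ c = comb (k^-1 * (s * dotp al c)) (scale (- s^-1) a)
       (k^-1 * (t * dotp be c)) (scale (- t^-1) b)).
    by apply: convex_cone2 => //; [exact: P2o0|exact: ltW|exact: ltW|lra].
  rewrite [in LHS](dual_basisE c fr) /comb /scale /=.
  by congr pair; field; rewrite !gt_eqF.
- split=> //; rewrite /cuts /= !comb_dotp !dotp_scale ab bb andbT.
  by apply/and3P; split; lra.
- split=> //; rewrite /cuts /= !comb_dotp !dotp_scale aa ba andbT.
  by apply/and3P; split; lra.
- move=> q [/cbd q1]; rewrite /cuts /= !comb_dotp !dotp_scale => /and4P[_ _ h _].
  by split=> //; move: h; rewrite /k; lra.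
Qed.

(** Cutting along both coordinate axes leaves four sectors, one for each quadrant. *)
Theorem valuation_eq0 P : P2o P -> nu P = 0.
Proof.
move=> PP; have cP := P2o_convex PP.
have e1 : ((1, 0) : R * R) != (0, 0) by rewrite -pair_eqE /= /pair_eq /= oner_eq0.
have e2 : ((0, 1) : R * R) != (0, 0).
  by rewrite -pair_eqE /= /pair_eq /= oner_eq0 andbF.
have [A A0 bda] := boundary_pt_on_ray PP e1.
have [B B0 bdb] := boundary_pt_on_ray PP e2.
have e1' : ((-1, 0) : R * R) != (0, 0).
  by rewrite -pair_eqE /= /pair_eq /= oppr_eq0 oner_eq0.
have e2' : ((0, -1) : R * R) != (0, 0).
  by rewrite -pair_eqE /= /pair_eq /= oppr_eq0 oner_eq0 andbF.
have [C C0 bda'] := boundary_pt_on_ray PP e1'.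
have [D D0 bdb'] := boundary_pt_on_ray PP e2'.
(* With these ratios [- a / s] and [- b / t] are the boundary points opposite to [a] and [b]. *)
pose s := A / C; pose t := B / D.
have s0 : 0 < s by rewrite divr_gt0.
have t0 : 0 < t by rewrite divr_gt0.
set a := scale A (1, 0) in bda; set b := scale B (0, 1) in bdb.
have a'E : scale C (-1, 0) = scale (- s^-1) a.
  by rewrite /s /a /scale /=; congr pair; field; rewrite !gt_eqF.
have b'E : scale D (0, -1) = scale (- t^-1) b.
  by rewrite /t /b /scale /=; congr pair; field; rewrite !gt_eqF.
rewrite {}a'E in bda'; rewrite {}b'E in bdb'.
pose al := (A^-1, 0) : R * R; pose be := (0, B^-1) : R * R.
have fr : dual_basis al be a b.
  by split; rewrite /dotp /al /be /a /b /scale /=; field; rewrite gt_eqF.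
clearbody a b al be s t => {e1 e2 e1' e2' A A0 B B0 C C0 D D0}.
have Pa := bda.1; have Pb := bdb.1; have Pa' := bda'.1; have Pb' := bdb'.1.
have ss : s * s^-1 = 1 by rewrite divff // gt_eqF.
have tt : t * t^-1 = 1 by rewrite divff // gt_eqF.
have s0' : 0 < s^-1 by rewrite invr_gt0.
have t0' : 0 < t^-1 by rewrite invr_gt0.
have flip r u : 0 < r -> scale (- r^-1^-1) (scale (- r^-1) u) = u.
  move=> r0; rewrite [RHS]surjective_pairing /scale /=.
  by congr pair; field; rewrite gt_eqF.
(* The sides of the quadrilateral [a], [b], [- a / s], [- b / t]; the sector of a quadrant is cut by
   all of them except the side in that quadrant. *)
pose l1 := comb 1 al 1 be; pose l2 := comb (- s) al 1 be.
pose l3 := comb (- s) al (- t) be; pose l4 := comb 1 al (- t) be.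
pose al' := comb (- s) al 0 be; pose be' := comb 0 al (- t) be.
have [aa ba ab bb] := fr.
have fra : dual_basis al' be (scale (- s^-1) a) b.
  by split; rewrite !(comb_dotp, dotp_scale, aa, ab, ba, bb); lra.
have frb : dual_basis al be' a (scale (- t^-1) b).
  by split; rewrite !(comb_dotp, dotp_scale, aa, ab, ba, bb); lra.
have frab : dual_basis al' be' (scale (- s^-1) a) (scale (- t^-1) b).
  by split; rewrite !(comb_dotp, dotp_scale, aa, ab, ba, bb); lra.
have Paa : P (scale (- s^-1^-1) (scale (- s^-1) a)) by rewrite flip.
have Pbb : P (scale (- t^-1^-1) (scale (- t^-1) b)) by rewrite flip.
have sec al0 be0 a0 b0 s1 t1 : dual_basis al0 be0 a0 b0 -> boundary_pt P a0 ->
    boundary_pt P b0 -> 0 < s1 -> 0 < t1 -> P (scale (- s1^-1) a0) ->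
    P (scale (- t1^-1) b0) -> nu (sector P al0 be0 s1 t1) = 0.
  case: (PP) => -[gens PE] _; rewrite PE in PP *.
  by move=> *; apply: (@sector_eq0 gens (size gens) _ _ a0 b0) => //; exact: count_size.
have P1 : nu (P `&` cuts [:: l4; l2; l3]) = 0 by exact: (sec _ _ _ _ _ _ fr).
have P2 : nu (P `&` cuts [:: l3; l1; l4]) = 0.
  rewrite -(sec _ _ _ _ _ _ fra bda' bdb s0' t0 Paa Pb') /sector.
  congr (nu (P `&` cuts [:: _; _; _])); rewrite /l1 /l3 /l4 /al' /comb /=;
    by congr pair; field; rewrite ?gt_eqF.
have P3 : nu (P `&` cuts [:: l1; l3; l2]) = 0.
  rewrite -(sec _ _ _ _ _ _ frb bda bdb' s0 t0' Pa' Pbb) /sector.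
  congr (nu (P `&` cuts [:: _; _; _])); rewrite /l1 /l2 /l3 /be' /comb /=;
    by congr pair; field; rewrite ?gt_eqF.
have P4 : nu (P `&` cuts [:: l2; l4; l1]) = 0.
  rewrite -(sec _ _ _ _ _ _ frab bda' bdb' s0' t0' Paa Pbb) /sector.
  congr (nu (P `&` cuts [:: _; _; _])); rewrite /l1 /l2 /l4 /al' /be' /comb /=;
    by congr pair; field; rewrite ?gt_eqF.
have sidesa : quad_sides a s be b (scale (- t^-1) b) l1 l2 l4 l3.
  split=> //; do ?split=> //;
    rewrite !(comb_dotp, dotp_scale, aa, ab, ba, bb); lra.
have sidesb : quad_sides b t al a (scale (- s^-1) a) l1 l4 l2 l3.
  split=> //; do ?split=> //;
    rewrite !(comb_dotp, dotp_scale, aa, ab, ba, bb); lra.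
have bda2 r : P (scale r a) -> r <= 1 /\ - s * r <= 1.
  move=> Pr; split; first exact: (bda.2 r).
  apply: bda'.2; rewrite (_ : scale _ _ = scale r a) //.
  by rewrite /scale /=; congr pair; field; rewrite gt_eqF.
have bdb2 r : P (scale r b) -> r <= 1 /\ - t * r <= 1.
  move=> Pr; split; first exact: (bdb.2 r).
  apply: bdb'.2; rewrite (_ : scale _ _ = scale r b) //.
  by rewrite /scale /=; congr pair; field; rewrite gt_eqF.
rewrite (cut_chord nuval nuquad sidesa) //.
have v1a : dotp l1 a <= 1 by rewrite !(comb_dotp, aa, ba); lra.
have v2a : dotp l2 a <= 1 by rewrite !(comb_dotp, aa, ba); lra.
have v3a : dotp l3 a <= 1 by rewrite !(comb_dotp, aa, ba); lra.
have v4a : dotp l4 a <= 1 by rewrite !(comb_dotp, aa, ba); lra.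
have v1b : dotp l1 b <= 1 by rewrite !(comb_dotp, ab, bb); lra.
have v2b : dotp l2 b <= 1 by rewrite !(comb_dotp, ab, bb); lra.
have v3b : dotp l3 b <= 1 by rewrite !(comb_dotp, ab, bb); lra.
have v4b : dotp l4 b <= 1 by rewrite !(comb_dotp, ab, bb); lra.
have va' l : dotp l (scale (- s^-1) a) = - s^-1 * dotp l a by rewrite dotp_scale.
have v1a' : dotp l1 (scale (- s^-1) a) <= 1 by rewrite va' !(comb_dotp, aa, ba); lra.
have v2a' : dotp l2 (scale (- s^-1) a) <= 1 by rewrite va' !(comb_dotp, aa, ba); lra.
have v3a' : dotp l3 (scale (- s^-1) a) <= 1 by rewrite va' !(comb_dotp, aa, ba); lra.
have v4a' : dotp l4 (scale (- s^-1) a) <= 1 by rewrite va' !(comb_dotp, aa, ba); lra.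
have vb' l : dotp l (scale (- t^-1) b) = - t^-1 * dotp l b by rewrite dotp_scale.
have v1b' : dotp l1 (scale (- t^-1) b) <= 1 by rewrite vb' !(comb_dotp, ab, bb); lra.
have v2b' : dotp l2 (scale (- t^-1) b) <= 1 by rewrite vb' !(comb_dotp, ab, bb); lra.
have v3b' : dotp l3 (scale (- t^-1) b) <= 1 by rewrite vb' !(comb_dotp, ab, bb); lra.
have v4b' : dotp l4 (scale (- t^-1) b) <= 1 by rewrite vb' !(comb_dotp, ab, bb); lra.
clearbody l1 l2 l3 l4.
rewrite (cut_chord nuval nuquad sidesb (P2o_cuts [:: l1; l2] PP)); first last.
- by move=> r [/bdb2].
- by split=> //; rewrite /cuts /= v1a' v2a'.
- by split=> //; rewrite /cuts /= v1a v2a.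
- by split=> //; rewrite /cuts /= v1b' v2b'.
- by split=> //; rewrite /cuts /= v1b v2b.
rewrite (cut_chord nuval nuquad sidesb (P2o_cuts [:: l4; l3] PP)); first last.
- by move=> r [/bdb2].
- by split=> //; rewrite /cuts /= v3a' v4a'.
- by split=> //; rewrite /cuts /= v3a v4a.
- by split=> //; rewrite /cuts /= v3b' v4b'.
- by split=> //; rewrite /cuts /= v3b v4b.
have merge ks ks' ks'' : (forall x, all (fun l => dotp l x <= 1) (ks ++ ks') =
    all (fun l => dotp l x <= 1) ks'') -> P `&` cuts ks `&` cuts ks' = P `&` cuts ks''.
  move=> h; rewrite -setIA; congr (_ `&` _); apply/seteqP; split=> x.
    by rewrite /cuts /= -h all_cat => -[-> ->].
  by rewrite /cuts /= -h all_cat => /andP[].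
rewrite (merge _ _ [:: l2; l4; l1]) ?P4; last first.
  by move=> x /=; do 3!case: (dotp _ x <= 1).
rewrite (merge _ _ [:: l1; l3; l2]) ?P3; last first.
  by move=> x /=; do 3!case: (dotp _ x <= 1).
rewrite (merge _ _ [:: l3; l1; l4]) ?P2; last first.
  by move=> x /=; do 3!case: (dotp _ x <= 1).
rewrite (merge _ _ [:: l4; l2; l3]) ?P1 ?addr0 //.
by move=> x /=; do 3!case: (dotp _ x <= 1).
Qed.

End SectorInduction.

(** * Covariance and quadrilaterals *)

Section Covariant.
Variable R : realType.
Implicit Types (x y l a b c v w : R * R) (P Q : set (R * R)).

(** * Two by two matrices in coordinates *)

Definition mx22 (a b c d : R) : 'M[R]_2 :=
  \matrix_(i, j) if i == ord0 then if j == ord0 then a else b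
                 else if j == ord0 then c else d.

Definition o1 : 'I_2 := lift ord0 ord0.

Lemma mul22E m n (A : 'M[R]_(m, 2)) (B : 'M[R]_(2, n)) i j :
  (A *m B) i j = A i ord0 * B ord0 j + A i o1 * B o1 j.
Proof. by rewrite mxE !big_ord_recl big_ord0 addr0. Qed.

Lemma mx22P (A B : 'M[R]_2) : A ord0 ord0 = B ord0 ord0 -> A ord0 o1 = B ord0 o1 ->
  A o1 ord0 = B o1 ord0 -> A o1 o1 = B o1 o1 -> A = B.
Proof.
move=> h1 h2 h3 h4; apply/matrixP => i j.
have ord2 (k : 'I_2) : k = ord0 \/ k = o1.
  case: k => -[|[|//]] k2; [left|right]; exact: val_inj.
by have [->|->] := ord2 i; have [->|->] := ord2 j.
Qed.

Lemma sandwichE (a b c d : R) (A : 'M[R]_2) :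
  let B := mx22 a b c d *m A *m (mx22 a b c d)^T in
  [/\ B ord0 ord0 = a * (a * A ord0 ord0 + b * A ord0 o1) + b * (a * A o1 ord0 + b * A o1 o1),
      B ord0 o1 = a * (c * A ord0 ord0 + d * A ord0 o1) + b * (c * A o1 ord0 + d * A o1 o1),
      B o1 ord0 = c * (a * A ord0 ord0 + b * A ord0 o1) + d * (a * A o1 ord0 + b * A o1 o1) &
      B o1 o1 = c * (c * A ord0 ord0 + d * A ord0 o1) + d * (c * A o1 ord0 + d * A o1 o1)].
Proof. by rewrite /=; split; rewrite !mul22E !mxE /=; ring. Qed.

Lemma det22 (a b c d : R) : \det (mx22 a b c d) = a * d - b * c.
Proof.
rewrite (expand_det_row _ ord0) !big_ord_recl big_ord0 addr0 /cofactor !det_mx11 !mxE /=.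
by rewrite expr0 expr1; ring.
Qed.

Lemma lin_act22 (a b c d : R) x :
  lin_act (mx22 a b c d) x = (a * x.1 + b * x.2, c * x.1 + d * x.2).
Proof. by rewrite /lin_act /= !mul22E !mxE /= /coord /=. Qed.

Variable nu : set (R * R) -> 'M[R]_2.
Hypothesis nuval : valuation_P2o nu.
Hypothesis nucov : GL2_covariant nu.

(** Covariance with the image given by a membership test, so that defining inequalities can be
    compared directly. *)
Lemma covariantE P Q (a b c d : R) : P2o P -> a * d - b * c != 0 ->
  (forall x, Q (a * x.1 + b * x.2, c * x.1 + d * x.2) <-> P x) ->
  nu Q = `|a * d - b * c| *: (mx22 a b c d *m nu P *m (mx22 a b c d)^T).
Proof.
move=> PP D0 PQ; rewrite -det22 -nucov //; last by rewrite unitmxE det22 unitfE.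
congr nu; apply/seteqP; split=> [y Qy|_ [x Px <-]]; last by rewrite lin_act22; apply/PQ.
pose x := ((d * y.1 - b * y.2) / (a * d - b * c), (a * y.2 - c * y.1) / (a * d - b * c)).
have yE : y = (a * x.1 + b * x.2, c * x.1 + d * x.2).
  by rewrite [LHS]surjective_pairing /x /=; congr pair; field.
by exists x; [apply/PQ; rewrite -yE|rewrite lin_act22 -yE].
Qed.

(** The list holds the polar points of the sides. The diagonal runs from [(-1 / s, 0)] to
    [(1 / r, 0)]; unprimed parameters belong to the upper half, primed ones to the lower half. *)
Definition quad (r s p q p' q' : R) : set (R * R) :=
  cuts [:: (r, p); (- s, q); (r, - p'); (- s, - q')].

Lemma quadP (r s p q p' q' : R) x : quad r s p q p' q' x <->
  [/\ r * x.1 + p * x.2 <= 1, - s * x.1 + q * x.2 <= 1,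
      r * x.1 - p' * x.2 <= 1 & - s * x.1 - q' * x.2 <= 1].
Proof.
rewrite /quad /cuts /= /dotp /= !mulNr andbT.
by split=> [/and4P[]|[-> -> -> ->]].
Qed.

(** Positivity of the two sums says that the upper sides meet above the first axis, at height
    [(r + s) / (s * p + r * q)], and the lower ones likewise below it; this bounds the set. *)
Lemma P2o_quad (r s p q p' q' : R) : 0 < r -> 0 < s ->
  0 < s * p + r * q -> 0 < s * p' + r * q' -> P2o (quad r s p q p' q').
Proof.
move=> r0 s0 u0 d0.
pose M := (r + s) / (s * p + r * q) + (r + s) / (s * p' + r * q').
have M1 : 0 <= (r + s) / (s * p + r * q) by rewrite divr_ge0 //; lra.
have M2 : 0 <= (r + s) / (s * p' + r * q') by rewrite divr_ge0 //; lra.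
pose N1 := (1 + `|p| * M) / r + (1 + `|q| * M) / s.
apply: (@P2o_bounded_cuts _ _ (M + N1)) => x /quadP[h1 h2 h3 h4].
have x2u : x.2 <= (r + s) / (s * p + r * q).
  rewrite ler_pdivlMr //.
  have : s * (r * x.1 + p * x.2) <= s * 1 by rewrite ler_pM2l.
  have : r * (- s * x.1 + q * x.2) <= r * 1 by rewrite ler_pM2l.
  lra.
have x2d : - x.2 <= (r + s) / (s * p' + r * q').
  rewrite ler_pdivlMr //.
  have : s * (r * x.1 - p' * x.2) <= s * 1 by rewrite ler_pM2l.
  have : r * (- s * x.1 - q' * x.2) <= r * 1 by rewrite ler_pM2l.
  lra.
have x2M : `|x.2| <= M by rewrite ler_norml /M; apply/andP; split; lra.
have M0 : 0 <= M by apply: le_trans x2M.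
have bd (z : R) : - (z * x.2) <= `|z| * M.
  by rewrite -mulrN; apply: le_trans (ler_norm _) _; rewrite normrM normrN ler_wpM2l.
have x1u : x.1 <= (1 + `|p| * M) / r by rewrite ler_pdivlMr //; have := bd p; lra.
have x1d : - x.1 <= (1 + `|q| * M) / s by rewrite ler_pdivlMr //; have := bd q; lra.
have e1 : 0 <= (1 + `|p| * M) / r.
  by apply: divr_ge0; [apply: addr_ge0; rewrite ?mulr_ge0|exact: ltW].
have e2 : 0 <= (1 + `|q| * M) / s.
  by apply: divr_ge0; [apply: addr_ge0; rewrite ?mulr_ge0|exact: ltW].
split; first by rewrite ler_norml /N1; apply/andP; split; lra.
by apply: (le_trans x2M); rewrite /N1; lra.
Qed.

(* The inequalities [0 <= p + p'] and [0 <= q + q'] say that the ends of the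
   diagonal on the first axis are on the boundary of the quadrilateral. *)
Definition quad_ok (r s p q p' q' : R) :=
  [/\ 0 < r /\ 0 < s, 0 < s * p + r * q, 0 < s * p' + r * q' &
      0 <= p + p' /\ 0 <= q + q'].

(** Larger parameters give a smaller half. So the union of the two mixed quadrilaterals on the right
    has both larger halves and their intersection both smaller ones. *)
Lemma quad_exchange_nested (r s p q p' q' p2 q2 p2' q2' : R) :
  quad_ok r s p q p' q' -> p <= p2 -> q <= q2 -> p' <= p2' -> q' <= q2' ->
  nu (quad r s p q p' q') + nu (quad r s p2 q2 p2' q2') =
  nu (quad r s p q p2' q2') + nu (quad r s p2 q2 p' q').
Proof.
move=> [[r0 s0] u0 d0 [pp qq]] lp lq lp' lq'.
have u20 : 0 < s * p2 + r * q2.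
  by apply: (lt_le_trans u0); rewrite lerD // ler_pM2l.
have d20 : 0 < s * p2' + r * q2'.
  by apply: (lt_le_trans d0); rewrite lerD // ler_pM2l.
have E1 : quad r s p q p2' q2' `|` quad r s p2 q2 p' q' = quad r s p q p' q'.
  apply/seteqP; split=> x.
    case=> /quadP[h1 h2 h3 h4]; apply/quadP; split=> //; case: (leP 0 x.2) => x20.
    - have : 0 <= (p + p') * x.2 by rewrite mulr_ge0.
      lra.
    - have : 0 <= (p2' - p') * - x.2 by rewrite mulr_ge0 //; lra.
      lra.
    - have : 0 <= (q + q') * x.2 by rewrite mulr_ge0.
      lra.
    - have : 0 <= (q2' - q') * - x.2 by rewrite mulr_ge0 //; lra.
      lra.
    - have : 0 <= (p2 - p) * x.2 by rewrite mulr_ge0 //; lra.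
      lra.
    - have : 0 <= (p + p') * - x.2 by rewrite mulr_ge0 //; lra.
      lra.
    - have : 0 <= (q2 - q) * x.2 by rewrite mulr_ge0 //; lra.
      lra.
    - have : 0 <= (q + q') * - x.2 by rewrite mulr_ge0 //; lra.
      lra.
  move=> /quadP[h1 h2 h3 h4]; case: (leP 0 x.2) => x20; [left|right]; apply/quadP.
    split; [exact: h1|exact: h2| |].
      have : 0 <= (p2' - p') * x.2 by rewrite mulr_ge0 //; lra.
      lra.
    have : 0 <= (q2' - q') * x.2 by rewrite mulr_ge0 //; lra.
    lra.
  split; [| |exact: h3|exact: h4].
    have : 0 <= (p2 - p) * - x.2 by rewrite mulr_ge0 //; lra.
    lra.
  have : 0 <= (q2 - q) * - x.2 by rewrite mulr_ge0 //; lra.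
  lra.
have E2 : quad r s p q p2' q2' `&` quad r s p2 q2 p' q' = quad r s p2 q2 p2' q2'.
  apply/seteqP; split=> x; first by move=> [/quadP[? ? ? ?] /quadP[? ? ? ?]]; apply/quadP.
  move=> /quadP[h1 h2 h3 h4]; split; apply/quadP; split=> //; case: (leP 0 x.2) => x20.
  - have : 0 <= (p2 - p) * x.2 by rewrite mulr_ge0 //; lra.
    lra.
  - have : 0 <= (p + p2') * - x.2 by rewrite mulr_ge0 //; lra.
    lra.
  - have : 0 <= (q2 - q) * x.2 by rewrite mulr_ge0 //; lra.
    lra.
  - have : 0 <= (q + q2') * - x.2 by rewrite mulr_ge0 //; lra.
    lra.
  - have : 0 <= (p2 + p') * x.2 by rewrite mulr_ge0 //; lra.
    lra.
  - have : 0 <= (p2' - p') * - x.2 by rewrite mulr_ge0 //; lra.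
    lra.
  - have : 0 <= (q2 + q') * x.2 by rewrite mulr_ge0 //; lra.
    lra.
  - have : 0 <= (q2' - q') * - x.2 by rewrite mulr_ge0 //; lra.
    lra.
have := nuval (P2o_quad r0 s0 u0 d20) (P2o_quad r0 s0 u20 d0).
rewrite E1 E2; apply; exact: P2o_quad.
Qed.

(** Each quadrilateral is compared with the one whose parameters are the maxima, and the four nested
    identities combine. In effect [nu] separates into an upper and a lower contribution. *)
Lemma quad_exchange (r s p q p' q' p2 q2 p2' q2' : R) :
  quad_ok r s p q p' q' -> quad_ok r s p2 q2 p2' q2' ->
  quad_ok r s p q p2' q2' -> quad_ok r s p2 q2 p' q' ->
  nu (quad r s p q p' q') + nu (quad r s p2 q2 p2' q2') =
  nu (quad r s p q p2' q2') + nu (quad r s p2 q2 p' q').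
Proof.
move=> o1 o2 o3 o4.
have m (x y : R) : x <= Num.max x y /\ y <= Num.max x y.
  by rewrite !le_max !lexx orbT.
have [mp mp2] := m p p2; have [mq mq2] := m q q2.
have [mp' mp2'] := m p' p2'; have [mq' mq2'] := m q' q2'.
have e1 := quad_exchange_nested o1 mp mq mp' mq'.
have e2 := quad_exchange_nested o2 mp2 mq2 mp2' mq2'.
have e3 := quad_exchange_nested o3 mp mq mp2' mq2'.
have e4 := quad_exchange_nested o4 mp2 mq2 mp' mq'.
apply/matrixP => i j; rewrite !mxE.
move: e1 e2 e3 e4 => /matrixP/(_ i j) + /matrixP/(_ i j) + /matrixP/(_ i j) + /matrixP/(_ i j).
rewrite !mxE; lra.
Qed.

End Covariant.

(** * Kites and slanted quadrilaterals *)

Section Kites.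
Variable R : realType.
Implicit Types (P Q : set (R * R)) (s N x M y h u v k z : R).

(** Expanding [g (2 * x) 1] through 2 and through [x] gives [g x 1 / 4 = g x 1]. The condition at
    [(2, 1)] excludes the nonzero multiples of [x ^- 2 - y ^- 2]. *)
Lemma cocycle_eq0 (g : R -> R -> R) :
  (forall x y z : R, 0 < x -> 0 < y -> 0 < z -> g x y + g y z = g x z) ->
  (forall k x y, 0 < k -> 0 < x -> 0 < y -> g (k * x) (k * y) = k ^- 2 * g x y) ->
  g 2 1 = 0 -> forall x y, 0 < x -> 0 < y -> g x y = 0.
Proof.
move=> gc gh g21; have two0 : 0 < 2 :> R by rewrite ltr0n.
have gx1 x : 0 < x -> g x 1 = 0.
  move=> x0; have x20 : 0 < 2 * x by rewrite mulr_gt0.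
  have := gc (2 * x) 2 1 x20 two0 ltr01.
  have := gc (2 * x) x 1 x20 x0 ltr01.
  have := gh 2 x 1 two0 x0 ltr01.
  have := gh x 2 1 x0 two0 ltr01.
  by rewrite !mulr1 (mulrC x) g21 mulr0; lra.
move=> x y x0 y0.
have := gc x 1 y x0 ltr01 y0; rewrite gx1 // => <-.
have := gc 1 y 1 ltr01 y0 ltr01; rewrite !gx1 //; lra.
Qed.

Variable nu : set (R * R) -> 'M[R]_2.
Hypothesis nuval : valuation_P2o nu.
Hypothesis nucov : GL2_covariant nu.
Local Notation o1 := o1.

(** The parameters are reciprocals of half-diagonals: the vertices are [(1 / A, 0)], [(-1 / B, 0)],
    [(0, 1 / C)], [(0, -1 / D)]. *)
Definition kite (A B C D : R) := quad A B C C D D.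

Lemma kite_ok (A B C D : R) : 0 < A -> 0 < B -> 0 < C -> 0 < D -> quad_ok A B C C D D.
Proof.
by move=> *; split=> //; rewrite ?addr_gt0 ?mulr_gt0 //; split; rewrite addr_ge0 ?ltW.
Qed.

Lemma P2o_kite (A B C D : R) : 0 < A -> 0 < B -> 0 < C -> 0 < D -> P2o (kite A B C D).
Proof. by move=> *; apply: P2o_quad; rewrite ?addr_gt0 ?mulr_gt0. Qed.

Lemma kite_swap (A B C D : R) : 0 < A -> 0 < B -> 0 < C -> 0 < D ->
  [/\ nu (kite C D A B) ord0 ord0 = nu (kite A B C D) o1 o1,
      nu (kite C D A B) ord0 o1 = nu (kite A B C D) o1 ord0,
      nu (kite C D A B) o1 ord0 = nu (kite A B C D) ord0 o1 &
      nu (kite C D A B) o1 o1 = nu (kite A B C D) ord0 ord0].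
Proof.
move=> A0 B0 C0 D0.
have -> : nu (kite C D A B) = `|0 * 0 - 1 * 1| *:
    (mx22 0 1 1 0 *m nu (kite A B C D) *m (mx22 0 1 1 0)^T).
  apply: covariantE => //; first exact: P2o_kite.
  by move=> x; rewrite /kite; split=> /quadP[/= h1 h2 h3 h4]; apply/quadP; split=> /=; lra.
rewrite mulr0 mulr1 sub0r normrN normr1 scale1r.
have [-> -> -> ->] := sandwichE 0 1 1 0 (nu (kite A B C D)).
by split; ring.
Qed.

(** Covariance under the diagonal matrix with entries [u^-1] and [v^-1]; [v] may be negative, so
    that dilations and the reflection in the first axis are both covered. *)
Lemma kite_scale (A B C D u v : R) : 0 < A -> 0 < B -> 0 < C -> 0 < D -> 0 < u -> v != 0 ->
  forall Q, (forall x : R * R, Q (u^-1 * x.1, v^-1 * x.2) <-> kite A B C D x) ->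
  [/\ nu Q ord0 ord0 = u ^- 3 * `|v^-1| * nu (kite A B C D) ord0 ord0,
      nu Q ord0 o1 = u ^- 2 * v^-1 * `|v^-1| * nu (kite A B C D) ord0 o1,
      nu Q o1 ord0 = u ^- 2 * v^-1 * `|v^-1| * nu (kite A B C D) o1 ord0 &
      nu Q o1 o1 = u^-1 * v ^- 2 * `|v^-1| * nu (kite A B C D) o1 o1].
Proof.
move=> A0 B0 C0 D0 u0 v0 Q QP.
have -> : nu Q = `|u^-1 * v^-1 - 0 * 0| *:
    (mx22 u^-1 0 0 v^-1 *m nu (kite A B C D) *m (mx22 u^-1 0 0 v^-1)^T).
  apply: covariantE => //; first exact: P2o_kite.
    by rewrite mulr0 subr0 mulf_neq0 // invr_neq0 // gt_eqF.
  by move=> x; rewrite !mul0r addr0 add0r.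
rewrite mulr0 subr0 normrM gtr0_norm ?invr_gt0 //.
rewrite ![(_ *: _ : 'M[R]_2) _ _]mxE.
have [-> -> -> ->] := sandwichE u^-1 0 0 v^-1 (nu (kite A B C D)).
have -> : u ^- 3 = u^-1 * u^-1 * u^-1 by rewrite -exprVn; ring.
have -> : u ^- 2 = u^-1 * u^-1 by rewrite -exprVn; ring.
have -> : v ^- 2 = v^-1 * v^-1 by rewrite -exprVn; ring.
by split; ring.
Qed.

Lemma kite_dilate (A B C D u v : R) : 0 < A -> 0 < B -> 0 < C -> 0 < D -> 0 < u -> 0 < v ->
  [/\ nu (kite (u * A) (u * B) (v * C) (v * D)) ord0 ord0 =
         u ^- 3 * v^-1 * nu (kite A B C D) ord0 ord0,
      nu (kite (u * A) (u * B) (v * C) (v * D)) ord0 o1 =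
         u ^- 2 * v ^- 2 * nu (kite A B C D) ord0 o1,
      nu (kite (u * A) (u * B) (v * C) (v * D)) o1 ord0 =
         u ^- 2 * v ^- 2 * nu (kite A B C D) o1 ord0 &
      nu (kite (u * A) (u * B) (v * C) (v * D)) o1 o1 =
         u^-1 * v ^- 3 * nu (kite A B C D) o1 o1].
Proof.
move=> A0 B0 C0 D0 u0 v0.
have vn : v != 0 by rewrite gt_eqF.
have un : u != 0 by rewrite gt_eqF.
have [|-> -> -> ->] := @kite_scale A B C D u v A0 B0 C0 D0 u0 vn
  (kite (u * A) (u * B) (v * C) (v * D)).
  move=> x.
  have cu (z : R) : u * z * (u^-1 * x.1) = z * x.1 by field.
  have cv (z : R) : v * z * (v^-1 * x.2) = z * x.2 by field.
  by rewrite /kite; split=> /quadP[/= h1 h2 h3 h4]; apply/quadP;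
    move: h1 h2 h3 h4; rewrite /= !mulNr !cu !cv.
rewrite gtr0_norm ?invr_gt0 //.
have -> : v ^- 3 = v^-1 * v^-1 * v^-1 by rewrite -exprVn; ring.
have -> : v ^- 2 = v^-1 * v^-1 by rewrite -exprVn; ring.
by split; ring.
Qed.

Lemma kite_flip (A B C D : R) : 0 < A -> 0 < B -> 0 < C -> 0 < D ->
  [/\ nu (kite A B D C) ord0 ord0 = nu (kite A B C D) ord0 ord0,
      nu (kite A B D C) ord0 o1 = - nu (kite A B C D) ord0 o1,
      nu (kite A B D C) o1 ord0 = - nu (kite A B C D) o1 ord0 &
      nu (kite A B D C) o1 o1 = nu (kite A B C D) o1 o1].
Proof.
move=> A0 B0 C0 D0.
have n1 : (-1 : R) != 0 by rewrite oppr_eq0 oner_eq0.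
have [|-> -> -> ->] := @kite_scale A B C D 1 (-1) A0 B0 C0 D0 ltr01 n1 (kite A B D C).
  move=> x; rewrite /kite invrN invr1.
  by split=> /quadP[/= h1 h2 h3 h4]; apply/quadP; split=> /=; lra.
by rewrite invrN invr1 normrN normr1 !expr1n ?invr1 sqrrN expr1n invr1; split; ring.
Qed.

Lemma kite_exchange (A B C D C' D' : R) : 0 < A -> 0 < B -> 0 < C -> 0 < D ->
  0 < C' -> 0 < D' ->
  nu (kite A B C D) + nu (kite A B C' D') = nu (kite A B C D') + nu (kite A B C' D).
Proof. by move=> *; apply: quad_exchange => //; exact: kite_ok. Qed.

(** The reflection in the first axis fixes this kite and negates the off-diagonal entries. *)
Lemma kite_offdiag_same (A B C : R) : 0 < A -> 0 < B -> 0 < C ->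
  nu (kite A B C C) ord0 o1 = 0 /\ nu (kite A B C C) o1 ord0 = 0.
Proof. by move=> A0 B0 C0; have [_ h1 h2 _] := kite_flip A0 B0 C0 C0; split; lra. Qed.

Hypothesis nu11 : nu (kite 1 1 1 1) ord0 ord0 = 0.

(** Reflection and exchange make a diagonal entry the mean of its values at two kites symmetric in
    the first axis. Swapping the coordinates and averaging again leaves rhombi, which are diagonal
    images of the normalised square. *)
Lemma kite_diag (A B C D : R) : 0 < A -> 0 < B -> 0 < C -> 0 < D ->
  nu (kite A B C D) ord0 ord0 = 0 /\ nu (kite A B C D) o1 o1 = 0.
Proof.
have square u v : 0 < u -> 0 < v ->
    nu (kite u u v v) ord0 ord0 = 0 /\ nu (kite u u v v) o1 o1 = 0.
  move=> u0 v0; have l1 := @ltr01 R.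
  have [_ _ _ h] := kite_swap l1 l1 l1 l1; rewrite nu11 in h.
  have [h1 _ _ h2] := kite_dilate l1 l1 l1 l1 u0 v0.
  by move: h1 h2; rewrite !mulr1 nu11 h !mulr0.
have half a b c d : 0 < a -> 0 < b -> 0 < c -> 0 < d ->
    2 * nu (kite a b c d) ord0 ord0 = nu (kite a b c c) ord0 ord0 + nu (kite a b d d) ord0 ord0
 /\ 2 * nu (kite a b c d) o1 o1 = nu (kite a b c c) o1 o1 + nu (kite a b d d) o1 o1.
  move=> a0 b0 c0 d0; have [h1 _ _ h2] := kite_flip a0 b0 c0 d0.
  have /matrixP e := kite_exchange a0 b0 c0 d0 d0 c0.
  by move: (e ord0 ord0) (e o1 o1); rewrite ![(_ + _ : 'M[R]_2) _ _]mxE h1 h2 !mulr_natl !mulr2n.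
have same a b c : 0 < a -> 0 < b -> 0 < c ->
    nu (kite a b c c) ord0 ord0 = 0 /\ nu (kite a b c c) o1 o1 = 0.
  move=> a0 b0 c0; have [-> _ _ ->] := kite_swap c0 c0 a0 b0.
  have [h1 h2] := half c c a b c0 c0 a0 b0.
  have [e1 e2] := square c a c0 a0; have [e3 e4] := square c b c0 b0.
  by split; lra.
move=> A0 B0 C0 D0; have [h1 h2] := half A B C D A0 B0 C0 D0.
have [e1 e2] := same A B C A0 B0 C0; have [e3 e4] := same A B D A0 B0 D0.
by split; lra.
Qed.

(* The quadrilateral with diagonal from (-1/s, 0) to (1, 0) whose remaining
   vertices are (x, 1) / N and - (x', 1) / N'. *)
Definition slanted s N x N' x' : set (R * R) :=
  quad 1 s (N - x) (N + s * x) (N' + x') (N' - s * x').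

(** This is [quad_ok] in the new parameters: the last two inequalities keep both ends of the
    diagonal on the boundary. *)
Definition slanted_ok s N x N' x' := [/\ 0 < s, 0 < N, 0 < N' &
  0 <= N + N' + (x' - x) /\ 0 <= N + N' - s * (x' - x)].

Lemma slanted_quad_ok s N x N' x' : slanted_ok s N x N' x' ->
  quad_ok 1 s (N - x) (N + s * x) (N' + x') (N' - s * x').
Proof.
move=> [s0 N0 N0' [h1 h2]]; have sN : 0 < s * N by rewrite mulr_gt0.
have sN' : 0 < s * N' by rewrite mulr_gt0.
by split; [split|lra|lra|split; lra].
Qed.

Lemma P2o_slanted s N x N' x' : slanted_ok s N x N' x' -> P2o (slanted s N x N' x').
Proof. by move=> /slanted_quad_ok[[r0 s0] h1 h2 _]; exact: P2o_quad. Qed.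

Lemma slanted_exchange s N x N' x' M y M' y' : slanted_ok s N x N' x' ->
  slanted_ok s M y M' y' -> slanted_ok s N x M' y' -> slanted_ok s M y N' x' ->
  nu (slanted s N x N' x') + nu (slanted s M y M' y') =
  nu (slanted s N x M' y') + nu (slanted s M y N' x').
Proof.
move=> /slanted_quad_ok ? /slanted_quad_ok ? /slanted_quad_ok ? /slanted_quad_ok ?.
exact: quad_exchange.
Qed.

Lemma slanted0 s N N' : slanted s N 0 N' 0 = kite 1 s N N'.
Proof. by rewrite /slanted /kite; congr quad; ring. Qed.

(** A shear along the first axis fixes the diagonal and translates both slopes by the same
    amount. *)
Lemma slanted_shear s N x N' x' y : slanted_ok s N x N' x' ->
  nu (slanted s N (x + y) N' (x' + y)) =
  mx22 1 y 0 1 *m nu (slanted s N x N' x') *m (mx22 1 y 0 1)^T.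
Proof.
move=> ok.
have -> : nu (slanted s N (x + y) N' (x' + y)) = `|1 * 1 - y * 0| *:
   (mx22 1 y 0 1 *m nu (slanted s N x N' x') *m (mx22 1 y 0 1)^T).
  apply: covariantE => //; first exact: P2o_slanted.
    by rewrite mulr0 subr0 mulr1 oner_eq0.
  by move=> z; rewrite /slanted; split=> /quadP[/= h1 h2 h3 h4]; apply/quadP; split=> /=; lra.
by rewrite mulr0 subr0 mulr1 normr1 scale1r.
Qed.

Lemma slanted_double s N x N' x' : slanted_ok s N x N' x' ->
  nu (slanted s (2 * N) (2 * x) (2 * N') (2 * x')) =
  2^-1 *: (mx22 1 0 0 2^-1 *m nu (slanted s N x N' x') *m (mx22 1 0 0 2^-1)^T).
Proof.
move=> ok.
have -> : nu (slanted s (2 * N) (2 * x) (2 * N') (2 * x')) = `|1 * 2^-1 - 0 * 0| *: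
   (mx22 1 0 0 2^-1 *m nu (slanted s N x N' x') *m (mx22 1 0 0 2^-1)^T).
  apply: covariantE => //; first exact: P2o_slanted.
  by move=> z; rewrite /slanted; split=> /quadP[/= h1 h2 h3 h4]; apply/quadP; split=> /=; lra.
by rewrite mulr0 subr0 mul1r ger0_norm // invr_ge0 ler0n.
Qed.

Lemma slanted_same s N x : 0 < s -> 0 < N -> nu (slanted s N x N x) = 0.
Proof.
move=> s0 N0; have ok : slanted_ok s N 0 N 0 by split=> //; split; lra.
have := slanted_shear x ok; rewrite add0r => ->; rewrite slanted0.
have [d1 d2] := kite_diag ltr01 s0 N0 N0.
have [f1 f2] := kite_offdiag_same ltr01 s0 N0.
rewrite (_ : nu (kite _ _ _ _) = 0) ?mulmx0 ?mul0mx //.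
by apply: mx22P; rewrite [RHS]mxE.
Qed.

(** Two relations involve the quadrilateral [e] of slope [h / 2]: [E] is the sum of [e] and a
    sheared copy of it, and halving the heights of [e] doubles its slope and level, while returning
    to level [N] costs [K] and its shear. The entries scale differently in the two, which determines
    them. *)
Lemma slanted_level s N h : 0 < s -> 0 < N -> 0 <= 2 * N + h -> 0 <= 2 * N - s * h ->
  let K := nu (kite 1 s (2 * N) N) in let E := nu (slanted s N 0 N h) in
  [/\ E ord0 ord0 = 4 / 3 * h * (K ord0 o1 + K o1 ord0), E ord0 o1 = 0,
      E o1 ord0 = 0 & E o1 o1 = 0].
Proof.
move=> s0 N0 h1 h2 K E.
have N20 : 0 < 2 * N by rewrite mulr_gt0.
have ok0 : slanted_ok s N 0 N (h / 2) by split=> //; split; lra.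
have ok1 : slanted_ok s N (h / 2) N h by split=> //; split; lra.
have ok2 : slanted_ok s N 0 N h by split=> //; split; lra.
have ok3 : slanted_ok s N (h / 2) N (h / 2) by split=> //; split; lra.
have ok4 : slanted_ok s (2 * N) 0 (2 * N) h by split=> //; split; lra.
have ok5 x : slanted_ok s N x N x by split=> //; split; lra.
have ok6 : slanted_ok s (2 * N) 0 N 0 by split=> //; split; lra.
have ok7 : slanted_ok s N 0 (2 * N) h by split=> //; split; lra.
have ok8 x : slanted_ok s N x (2 * N) x by split=> //; split; lra.
pose e := nu (slanted s N 0 N (h / 2)).
(* Exchange at the intermediate slope [h / 2]; the leftover quadrilateral with equal slopes
   vanishes. *)
have E1 : e + mx22 1 (h / 2) 0 1 *m e *m (mx22 1 (h / 2) 0 1)^T = E.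
  rewrite -slanted_shear // add0r (_ : h / 2 + h / 2 = h); last by field.
  by rewrite (slanted_exchange ok0 ok1 ok2 ok3) slanted_same // addr0.
(* The upper and then the lower vertex are moved from level [2 * N] to level [N]. *)
have E2 : 2^-1 *: (mx22 1 0 0 2^-1 *m e *m (mx22 1 0 0 2^-1)^T) =
    E + K - mx22 1 h 0 1 *m K *m (mx22 1 h 0 1)^T.
  rewrite -slanted_double // mulr0 (_ : 2 * (h / 2) = h); last by field.
  have := slanted_exchange ok4 (ok5 0) ok6 ok7.
  rewrite slanted_same // addr0 slanted0 -/K => ->.
  have := slanted_exchange ok7 (ok5 h) ok2 (ok8 h).
  rewrite slanted_same // addr0 => ->.
  have := slanted_shear h (ok8 0); rewrite add0r slanted0 => ->.
  have -> : nu (kite 1 s N (2 * N)) = - K.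
    have [k1 k2] := kite_diag ltr01 s0 N20 N0.
    have [f1 f2 f3 f4] := kite_flip ltr01 s0 N20 N0.
    by apply: mx22P; rewrite [RHS]mxE ?f1 ?f2 ?f3 ?f4 ?k1 ?k2 ?oppr0.
  by rewrite mulmxN mulNmx addrA [X in X - _]addrC.
have [K1 K2] : K ord0 ord0 = 0 /\ K o1 o1 = 0 := kite_diag ltr01 s0 N20 N0.
have [a1 a2 a3 a4] := sandwichE 1 (h / 2) 0 1 e.
have [b1 b2 b3 b4] := sandwichE 1 0 0 2^-1 e.
have [c1 c2 c3 c4] := sandwichE 1 h 0 1 K.
move/matrixP: E1 => E1; move/matrixP: E2 => E2.
move: (E1 ord0 ord0) (E1 ord0 o1) (E1 o1 ord0) (E1 o1 o1).
move: (E2 ord0 ord0) (E2 ord0 o1) (E2 o1 ord0) (E2 o1 o1).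
rewrite ![(_ + _ : 'M[R]_2) _ _]mxE ![(_ *: _ : 'M[R]_2) _ _]mxE ![(- _ : 'M[R]_2) _ _]mxE.
rewrite {}a1 {}a2 {}a3 {}a4 {}b1 {}b2 {}b3 {}b4 {}c1 {}c2 {}c3 {}c4 K1 K2.
move: (e ord0 ord0) (e ord0 o1) (e o1 ord0) (e o1 o1) => e1 e2 e3 e4.
move: (E ord0 ord0) (E ord0 o1) (E o1 ord0) (E o1 o1) => E00 E01 E10 E11.
move: (K ord0 o1) (K o1 ord0) => k1 k2.
move=> F00 F01 F10 F11 G00 G01 G10 G11.
(* The last entry satisfies [e4 / 8 = 2 * e4]. Off the diagonal the factors are 1/4 and 2; in the
   first entry they are 1/2 and 2, and the shear of [K] contributes [h * (k1 + k2)]. *)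
have z4 : e4 = 0 by lra.
move: F00 F01 F10 F11 G00 G01 G10 G11; rewrite z4 => F00 F01 F10 F11 G00 G01 G10 G11.
have z3 : e3 = 0 by lra.
have z2 : e2 = 0 by lra.
move: F00 F01 F10 F11 G00 G01 G10 G11; rewrite z3 z2 => F00 F01 F10 F11 G00 G01 G10 G11.
by split; lra.
Qed.

(** [slanted 2 1 0 1 1] is the triangle with vertices [(1, 0)], [(0, 1)], [(-1, -1)]. Exchanging
    coordinates equates its diagonal entries, so by [slanted_level] the off-diagonal entries of
    [kite 1 2 2 1] add up to 0; reflection and swap make them equal. *)
Lemma kite_offdiag_1221 : nu (kite 1 2 2 1) ord0 o1 = 0.
Proof.
have l1 := @ltr01 R; have l2 : 0 < 2 :> R by rewrite ltr0n.
have [] := @slanted_level 2 1 1 l2 l1; try lra.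
rewrite !mulr1 => h00 _ _ h11.
have TT : nu (slanted 2 1 0 1 1) = `|0 * 0 - 1 * 1| *:
    (mx22 0 1 1 0 *m nu (slanted 2 1 0 1 1) *m (mx22 0 1 1 0)^T).
  apply: covariantE => //.
  - by apply: P2o_slanted; split=> //; split; lra.
  - by move=> x; rewrite /slanted; split=> /quadP[/= h1 h2 h3 h4]; apply/quadP;
      split=> /=; lra.
have [s1 _ _ _] := sandwichE 0 1 1 0 (nu (slanted 2 1 0 1 1)).
move/matrixP: TT => /(_ ord0 ord0).
rewrite [(_ *: _ : 'M[R]_2) _ _]mxE s1 mulr0 mulr1 sub0r normrN normr1 h11 h00.
have [_ e1 e2 _] := kite_flip l1 l2 l2 l1.
have [_ e3 _ _] := kite_swap l1 l2 l1 l2.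
lra.
Qed.

(** Off-diagonal entries are cocycles in the vertical pair, homogeneous of degree -2. [cocycle_eq0]
    first settles the horizontal pair [(1, 2)]; the swap turns this into the normalisation at
    [(2, 1)] for every horizontal pair. *)
Lemma kite_eq0 (A B C D : R) : 0 < A -> 0 < B -> 0 < C -> 0 < D -> nu (kite A B C D) = 0.
Proof.
have l1 := @ltr01 R; have l2 : 0 < 2 :> R by rewrite ltr0n.
have coc i j (a b : R) : 0 < a -> 0 < b ->
    (forall c, 0 < c -> nu (kite a b c c) i j = 0) ->
    forall x y z : R, 0 < x -> 0 < y -> 0 < z ->
    nu (kite a b x y) i j + nu (kite a b y z) i j = nu (kite a b x z) i j.
  move=> a0 b0 cc x y z x0 y0 z0.
  have /matrixP/(_ i j) := kite_exchange a0 b0 x0 y0 y0 z0.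
  by rewrite ![(_ + _ : 'M[R]_2) _ _]mxE cc // addr0.
have c12 c d : 0 < c -> 0 < d -> nu (kite 1 2 c d) ord0 o1 = 0.
  apply: (@cocycle_eq0 (fun x y => nu (kite 1 2 x y) ord0 o1)).
  - apply: coc => // x x0; by case: (kite_offdiag_same l1 l2 x0).
  - move=> k x y k0 x0 y0; have [_ + _ _] := kite_dilate l1 l2 x0 y0 l1 k0.
    by rewrite !mul1r expr1n invr1 mul1r.
  - exact: kite_offdiag_1221.
have c01 a b c d : 0 < a -> 0 < b -> 0 < c -> 0 < d -> nu (kite c d a b) o1 ord0 = 0.
  move=> a0 b0 c0 d0; move: a b a0 b0.
  apply: (@cocycle_eq0 (fun x y => nu (kite c d x y) o1 ord0)).
  - apply: coc => // x x0; by case: (kite_offdiag_same c0 d0 x0).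
  - move=> k x y k0 x0 y0; have [_ _ + _] := kite_dilate c0 d0 x0 y0 l1 k0.
    by rewrite !mul1r expr1n invr1 mul1r.
  - have [_ _ -> _] := kite_flip c0 d0 l1 l2.
    by have [_ _ -> _] := kite_swap l1 l2 c0 d0; rewrite c12 ?oppr0.
move=> A0 B0 C0 D0; have [d1 d2] := kite_diag A0 B0 C0 D0.
apply: mx22P; rewrite [RHS]mxE //; last exact: c01.
by have [_ -> _ _] := kite_swap C0 D0 A0 B0; exact: c01.
Qed.

(** Raising both levels to their maximum costs only sheared kites, which vanish; a shear then moves
    the first slope to 0, where [slanted_level] applies with vanishing kites. *)
Lemma slanted_eq0 s N x N' x' : slanted_ok s N x N' x' -> nu (slanted s N x N' x') = 0.
Proof.
have same s0 M h : 0 < s0 -> 0 < M -> 0 <= 2 * M + h -> 0 <= 2 * M - s0 * h ->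
    nu (slanted s0 M 0 M h) = 0.
  move=> s00 M0 h1 h2; have M20 : 0 < 2 * M by rewrite mulr_gt0 // ltr0n.
  have [] := slanted_level s00 M0 h1 h2.
  rewrite (kite_eq0 ltr01 s00 M20 M0) !mxE addr0 mulr0 => e1 e2 e3 e4.
  by apply: mx22P; rewrite [RHS]mxE.
move=> [s0 N0 N0' [h1 h2]].
pose L := Num.max N N'.
have NL : N <= L by rewrite le_max lexx.
have NL' : N' <= L by rewrite le_max lexx orbT.
have L0 : 0 < L by apply: lt_le_trans NL.
have ok1 : slanted_ok s N x N' x' by split.
have ok2 y : slanted_ok s L y L y by split=> //; split; lra.
have ok3 : slanted_ok s N x L x by split=> //; split; lra.
have ok4 : slanted_ok s L x N' x' by split=> //; split; lra.
have ok5 : slanted_ok s L x' N' x' by split=> //; split; lra.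
have ok6 : slanted_ok s L x L x' by split=> //; split; lra.
have kite0 M y M' : 0 < M -> 0 < M' -> nu (slanted s M y M' y) = 0.
  move=> M0 M0'; have ok : slanted_ok s M 0 M' 0 by split=> //; split; lra.
  have := slanted_shear y ok; rewrite add0r => ->.
  by rewrite slanted0 kite_eq0 // mulmx0 mul0mx.
have := slanted_exchange ok1 (ok2 x) ok3 ok4.
rewrite (kite0 L x L L0 L0) (kite0 N x L N0 L0) addr0 add0r => ->.
have := slanted_exchange ok4 (ok2 x') ok6 ok5.
rewrite (kite0 L x' L L0 L0) (kite0 L x' N' L0 N0') !addr0 => ->.
have ok7 : slanted_ok s L 0 L (x' - x) by split=> //; split; lra.
have := slanted_shear x ok7; rewrite add0r subrK => ->.
by rewrite same ?mulmx0 ?mul0mx //; lra.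
Qed.

(** A linear change of coordinates with [a] as first basis vector brings the four sides into slanted
    form. *)
Lemma quad_eq0 (a g v w l1 l2 l3 l4 : R * R) (s : R) : quad_sides a s g v w l1 l2 l3 l4 ->
  dotp l3 v <= 1 -> dotp l4 v <= 1 -> nu (cuts [:: l1; l2; l3; l4]) = 0.
Proof.
move=> [s0 [ga gv gw] [h1a h1v] [h2a h2v] [[h3a h3w] [h4a h4w]]] h3v h4v.
have gvn : dotp g v != 0 by rewrite gt_eqF.
(* The second basis vector is parallel to the side through [a] and [v], which thus becomes
   [x.1 <= 1], with parameter [p = 0]. *)
pose e := scale (dotp g v)^-1 (comb 1 v (-1) a).
have l1e : dotp l1 e = 0 by rewrite dotp_scale dotp_comb h1a h1v; ring.
have l2e : dotp l2 e = (1 + s) / dotp g v.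
  by rewrite dotp_scale dotp_comb h2a h2v; field.
have l3e : dotp l3 e = (dotp l3 v - 1) / dotp g v.
  by rewrite dotp_scale dotp_comb h3a; field.
have l4e : dotp l4 e = (dotp l4 v + s) / dotp g v.
  by rewrite dotp_scale dotp_comb h4a; field.
have ge : dotp g e = 1 by rewrite dotp_scale dotp_comb ga; field.
have we : w = comb (dotp l1 w) a (dotp g w) e.
  by apply: (@dotp_inj _ l1 g a v) => //; rewrite dotp_comb ?h1a ?l1e ?ga ?ge; ring.
pose q := dotp l2 e; pose p' := - dotp l3 e; pose q' := - dotp l4 e.
have d0 : 0 < s * p' + q'.
  have e3 : dotp l1 w + dotp g w * dotp l3 e = 1.
    by rewrite -h3w [in RHS]we dotp_comb h3a mulr1.
  have e4 : dotp l1 w * - s + dotp g w * dotp l4 e = 1.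
    by rewrite -h4w [in RHS]we dotp_comb h4a.
  have E : (s * p' + q') * - dotp g w = 1 + s.
    have : s * (dotp l1 w + dotp g w * dotp l3 e) = s by rewrite e3 mulr1.
    by rewrite /p' /q'; lra.
  have : 0 < (s * p' + q') * - dotp g w by rewrite E; lra.
  by rewrite pmulr_lgt0 // oppr_gt0.
have q0 : 0 < q by rewrite /q l2e divr_gt0 //; lra.
have p'0 : 0 <= p'.
  by rewrite /p' l3e -mulNr divr_ge0 ?(ltW gv) // oppr_ge0 subr_le0.
have q'0 : 0 <= q + q'.
  rewrite /q /q' l2e l4e -mulrBl divr_ge0 ?(ltW gv) //; lra.
(* Obtained by solving [N - x = 0], [N + s * x = q], [N' + x' = p'], [N' - s * x' = q']. *)
pose N := q / (1 + s); pose N' := (s * p' + q') / (1 + s).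
have s1 : 1 + s != 0 by rewrite gt_eqF //; lra.
have ok : slanted_ok s N N N' (p' - N').
  split=> //; try (rewrite divr_gt0 //; lra).
  have e1 : N + N' + (p' - N' - N) = p' by ring.
  have e2 : N + N' - s * (p' - N' - N) = q + q' by rewrite /N /N'; field.
  by rewrite e1 e2.
have := slanted_eq0 ok; rewrite /slanted => S0.
have S0' : nu (quad 1 s 0 q p' q') = 0.
  by rewrite -S0; congr (nu (quad _ _ _ _ _ _)); rewrite /N /N'; field.
rewrite (@covariantE R nu nucov (quad 1 s 0 q p' q') _ a.1 e.1 a.2 e.2).
- by rewrite S0' mulmx0 mul0mx scaler0.
- apply: P2o_quad => //; lra.
- have : (a.1 * e.2 - e.1 * a.2) * (l1.1 * g.2 - l1.2 * g.1) =
    dotp l1 a * dotp g e - dotp l1 e * dotp g a by rewrite /dotp; ring.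
  rewrite h1a ge l1e mul0r subr0 mulr1 => D; apply/eqP => D0.
  by move: D; rewrite D0 mul0r => /eqP; rewrite eq_sym oner_eq0.
- move=> x.
  have dl (l : R * R) : dotp l (a.1 * x.1 + e.1 * x.2, a.2 * x.1 + e.2 * x.2) =
      x.1 * dotp l a + x.2 * dotp l e by rewrite /dotp /=; ring.
  rewrite /cuts /= !dl h1a h2a h3a h4a l1e -/q.
  have -> : dotp l3 e = - p' by rewrite /p' opprK.
  have -> : dotp l4 e = - q' by rewrite /q' opprK.
  split.
    by move=> /and5P[i1 i2 i3 i4 _]; apply/quadP; split; lra.
  by move=> /quadP[i1 i2 i3 i4]; rewrite andbT; apply/and4P; split; lra.
Qed.

Theorem covariant_eq0 P : P2o P -> nu P = 0.
Proof. by apply: valuation_eq0 => // a s g v w l1 l2 l3 l4; exact: quad_eq0. Qed.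

End Kites.

(** * The moment matrix *)

Section Moments.
Variable R : realType.
Implicit Types (P Q : set (R * R)).
Local Notation RR := (measurableTypeR R * measurableTypeR R)%type.

(** * Planar Lebesgue measure and integrability over polygons *)

Definition plane_measure : {measure set RR -> \bar R} :=
  [the measure _ _ of (lebesgue_measure \x lebesgue_measure)%E].

(** Links the topology to the product sigma-algebra: an open set is the union of the countably many
    boxes inside it with rational centre and radius the inverse of a positive integer. *)
Lemma open_measurable2 (U : set (R * R)) : open U -> measurable (U : set RR).
Proof.
move=> oU.
pose B (k : rat * rat * nat) : set RR :=
  `]ratr k.1.1 - k.2.+1%:R^-1, ratr k.1.1 + k.2.+1%:R^-1[%classic `*`
  `]ratr k.1.2 - k.2.+1%:R^-1, ratr k.1.2 + k.2.+1%:R^-1[%classic.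
have -> : U = \bigcup_k (if `[< B k `<=` U >] then B k else set0).
  apply/seteqP; split=> [x Ux|x [k _]]; last by case: asboolP => // h /h.
  have /nbhs_ballP[e /= e0 eU] : nbhs x U by exact: open_nbhs_nbhs.
  (* The choice [2 * t < e] serves as follows: a box of radius [t] centred within [t] of [x]
     contains [x] and stays in the ball of radius [e]. *)
  have [|n] := @ltr_add_invr R 0 (e / 2); first by rewrite divr_gt0.
  rewrite add0r => ne2.
  pose t : R := n.+1%:R^-1; have t0 : 0 < t by rewrite invr_gt0 ltr0n.
  have ne : 2 * t < e by move: ne2; rewrite -/t => ne2; lra.
  have [q /itvP hq] : exists q, ratr q \in `]x.1 - t, x.1 + t[.
    by apply: rat_in_itvoo; clearbody t; lra.
  have [r /itvP hr] : exists q, ratr q \in `]x.2 - t, x.2 + t[.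
    by apply: rat_in_itvoo; clearbody t; lra.
  have q1 : x.1 - t < ratr q by rewrite hq.
  have q2 : ratr q < x.1 + t by rewrite hq.
  have r1 : x.2 - t < ratr r by rewrite hr.
  have r2 : ratr r < x.2 + t by rewrite hr.
  have BE : B (q, r, n) = `]ratr q - t, ratr q + t[%classic `*`
    `]ratr r - t, ratr r + t[%classic by [].
  clearbody t; exists (q, r, n) => //; case: asboolP => [h|[]]; rewrite BE.
    by split; rewrite /= in_itv /=; apply/andP; split; lra.
  move=> y [/= + +]; rewrite !in_itv /= => /andP[y1 y2] /andP[y3 y4].
  by apply: eU; split; rewrite /ball /= ltr_norml; apply/andP; split; lra.
apply: countable_bigcupT_measurable => // k.
by case: asboolP => h //; apply: measurableX; exact: measurable_itv.
Qed.

Lemma P2o_measurable P : P2o P -> measurable (P : set RR).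
Proof.
move=> PP; rewrite -[P]setCK; apply: measurableC; apply: open_measurable2.
apply: closed_openC; apply: compact_closed; last exact: P2o_compact.
exact: norm_hausdorff.
Qed.

Lemma box_measure (N : R) : (plane_measure (box N) < +oo)%E.
Proof.
have -> : box N = `[- N, N]%classic `*` `[- N, N]%classic :> set (R * R).
  apply/seteqP; split=> x; rewrite /box /= !in_itv /= -!ler_norml; by case.
rewrite /= product_measure1E; try exact: measurable_itv.
rewrite /= !lebesgue_measure_itv /=; case: ifP => _; last by rewrite mule0 ltry.
by rewrite -EFinD -EFinM ltry.
Qed.

Lemma measurable_box (N : R) : measurable (box N : set RR).
Proof.
have -> : box N = `[- N, N]%classic `*` `[- N, N]%classic :> set (R * R).
  apply/seteqP; split=> x; rewrite /box /= !in_itv /= -!ler_norml; by case.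
by apply: measurableX; exact: measurable_itv.
Qed.

Definition monomial (i j : 'I_2) (x : RR) : R := Defs.coord x i * Defs.coord x j.

Lemma measurable_coord (i : 'I_2) :
  measurable_fun setT ((fun x => Defs.coord x i) : RR -> measurableTypeR R).
Proof.
rewrite /Defs.coord; case: (i == ord0); [exact: measurable_fst|exact: measurable_snd].
Qed.

Lemma measurable_monomial D i j :
  measurable_fun D (monomial i j : RR -> measurableTypeR R).
Proof.
by apply: measurable_funTS; apply: measurable_funM; exact: measurable_coord.
Qed.

Lemma integrable_monomial P i j : P2o P ->
  plane_measure.-integrable P (EFin \o monomial i j).
Proof.
move=> PP; have [N PN] := P2o_bounded PP; have mP := P2o_measurable PP.
apply: measurable_bounded_integrable => //.
- apply: le_lt_trans (box_measure N); apply: le_measure; rewrite ?inE //.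
  exact: measurable_box.
- exact: measurable_monomial.
- exists (N * N); split; first by rewrite num_real.
  move=> M NM x Px; apply: le_trans (ltW NM).
  have [h1 h2] := PN _ Px.
  have bd k : `|Defs.coord x k| <= N by rewrite /Defs.coord; case: (k == ord0).
  by rewrite /= /monomial normrM ler_pM.
Qed.

Lemma moment_matrixE P i j : moment_matrix P i j = Rintegral plane_measure P (monomial i j).
Proof. by rewrite mxE. Qed.

(** Integrals add over disjoint sets: the part of [L] outside [K] completes [K] to the union and the
    intersection to [L]. *)
Lemma moment_valuation : valuation_P2o (@moment_matrix R).
Proof.
move=> K L PK PL PU PI; apply/matrixP => i j; rewrite ![(_ + _ : 'M[R]_2) _ _]mxE !moment_matrixE.
have mK := P2o_measurable PK; have mL := P2o_measurable PL.
have mLK : measurable (L `\` K : set RR) by exact: measurableD.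
have disj (A B : set RR) : [disjoint A & B `\` A].
  by apply/disj_setPS => x [Ax []].
have e1 : K `|` L = K `|` (L `\` K).
  by rewrite setUDr setDv setD0 -?setUDr //; apply/seteqP; split => x; tauto.
have e2 : L = (K `&` L) `|` (L `\` K).
  apply/seteqP; split => x; last by case=> -[].
  by move=> Lx; case: (pselect (K x)); [left|right].
rewrite [in X in X + _]e1 [in RHS]e2.
rewrite (Rintegral_setU mK mLK) //; last by rewrite -e1; exact: integrable_monomial.
rewrite [X in _ = _ + X]Rintegral_setU //; last first.
- by apply/disj_setPS => x [[Kx _] []].
- by rewrite -e2; exact: integrable_monomial.
- exact: measurableI.
by rewrite addrAC addrA.
Qed.

End Moments.

(** * Covariance of the moment matrix *)

Section Covariance.
Variable R : realType.
Implicit Types (P Q : set (R * R)).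
Local Notation RR := (measurableTypeR R * measurableTypeR R)%type.
Local Notation leb := (@plane_measure R).

(** * Area under invertible linear maps *)

Lemma measurable_affine (u t : R) :
  measurable_fun setT ((fun x => u * x + t) : measurableTypeR R -> measurableTypeR R).
Proof.
by apply: measurable_funD => //.
Qed.

(** The left-hand side, as a function of [A], is a measure agreeing with Lebesgue measure on
    half-open intervals, hence everywhere. *)
Lemma lebesgue_measure_affine (u t : R) (A : set (measurableTypeR R)) : u != 0 ->
  measurable A ->
  (`|u|%:E * lebesgue_measure ((fun x : measurableTypeR R => (u * x + t)%R) @^-1` A) =
   lebesgue_measure A)%E.
Proof.
move=> u0 mA.
pose f : measurableTypeR R -> measurableTypeR R := fun x => u * x + t.
have mf : measurable_fun setT f := measurable_affine u t.
pose m : {measure set (measurableTypeR R) -> \bar R} :=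
  mscale (NngNum (normr_ge0 u))
      (measure_function_pushforward__canonical__measure_function_Measure lebesgue_measure mf).
apply/esym/(@lebesgue_measure_unique R m) => // _ [[a b]] _ <-.
rewrite /m /= /mscale /= /pushforward.
have uN : `|u| != 0 by rewrite normr_eq0.
have [u_gt0|u_lt0] := ltP 0 u.
  have -> : f @^-1` `]a, b]%classic = `](a - t) / u, (b - t) / u]%classic.
    apply/seteqP; split=> x; rewrite /f /= !in_itv /= ltr_pdivrMr // ler_pdivlMr //;
      by move=> /andP[h1 h2]; apply/andP; split; lra.
  rewrite !lebesgue_measure_itv /= !lte_fin ltr_pM2r ?invr_gt0 // ltrD2r.
  case: ifP => _; last by rewrite mule0.
  by rewrite -!EFinD -EFinM gtr0_norm //; congr EFin; field; rewrite gt_eqF.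
have {}u_lt0 : u < 0 by rewrite lt_neqAle u0.
(* A negative [u] moves the closed end of the interval to the left. *)
have -> : f @^-1` `]a, b]%classic = `[(b - t) / u, (a - t) / u[%classic.
  apply/seteqP; split=> x; rewrite /f /= !in_itv /= ltr_ndivlMr // ler_ndivrMr //;
    by move=> /andP[h1 h2]; apply/andP; split; lra.
rewrite !lebesgue_measure_itv /= !lte_fin ltr_nM2r ?invr_lt0 // ltrD2r.
case: ifP => _; last by rewrite mule0.
by rewrite -!EFinD -EFinM ltr0_norm //; congr EFin; field; rewrite lt_eqF.
Qed.

(** Phrased with preimages, so that it is an equality of measures: planar measure is [c] times its
    pushforward by [T]. For invertible linear [T] the constant is the absolute value of the
    determinant. *)
Definition dilates_area (c : R) (T : RR -> RR) :=
  measurable_fun setT T /\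
  forall A, measurable A -> (c%:E * leb (T @^-1` A) = leb A)%E.

Lemma dilates_area_comp c d T S : dilates_area c T -> dilates_area d S ->
  dilates_area (c * d) (T \o S).
Proof.
move=> [mT hT] [mS hS]; split; first exact: measurableT_comp.
move=> A mA; rewrite EFinM -muleA comp_preimage hS ?hT //.
by rewrite -[X in measurable X]setTI; exact: mT.
Qed.

(** Uniqueness of the product measure reduces the claim to rectangles. *)
Lemma dilates_area_rect c (T : RR -> RR) : 0 <= c -> measurable_fun setT T ->
  (forall A B, measurable A -> measurable B -> (c%:E * leb (T @^-1` (A `*` B)) =
    lebesgue_measure A * lebesgue_measure B)%E) -> dilates_area c T.
Proof.
move=> c0 mT h; split=> // A mA.
pose m : {measure set RR -> \bar R} :=
  mscale (NngNum c0) (measure_function_pushforward__canonical__measure_function_Measure leb mT).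
by apply/esym; apply: (@product_measure_unique _ _ _ _ R lebesgue_measure lebesgue_measure m).
Qed.

Lemma dilates_area_swap : dilates_area 1 (fun x : RR => (x.2, x.1) : RR).
Proof.
apply: dilates_area_rect => //.
  by apply: measurable_fun_pair; [exact: measurable_snd|exact: measurable_fst].
move=> A B mA mB; rewrite mul1e.
have -> : (fun x : RR => (x.2, x.1) : RR) @^-1` (A `*` B) = B `*` A.
  by apply/seteqP; split=> x [].
by rewrite /= product_measure1E // muleC.
Qed.

Lemma dilates_area_diag (u : R) : u != 0 ->
  dilates_area `|u| (fun x : RR => (u * x.1, x.2) : RR).
Proof.
move=> u0; apply: dilates_area_rect => //.
  apply: measurable_fun_pair; last exact: measurable_snd.
  by apply: measurable_funM => //; exact: measurable_fst.
move=> A B mA mB.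
have -> : (fun x : RR => (u * x.1, x.2) : RR) @^-1` (A `*` B) =
    ((fun x : measurableTypeR R => u * x + 0) @^-1` A) `*` B.
  by apply/seteqP; split=> x []; rewrite /= addr0.
have mA' : measurable ((fun x : measurableTypeR R => u * x + 0 : measurableTypeR R) @^-1` A).
  by rewrite -[X in measurable X]setTI; exact: measurable_affine.
by rewrite /= product_measure1E // muleA lebesgue_measure_affine.
Qed.

(** A shear does not preserve rectangles, so sections are used instead: on each vertical line it is
    a translation. *)
Lemma dilates_area_shear (t : R) :
  dilates_area 1 (fun x : RR => (x.1, x.2 + t * x.1) : RR).
Proof.
have mT : measurable_fun setT (fun x : RR => (x.1, x.2 + t * x.1) : RR).
  apply: measurable_fun_pair; first exact: measurable_fst.
  apply: measurable_funD; first exact: measurable_snd.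
  by apply: measurable_funM => //; exact: measurable_fst.
split=> // A mA; rewrite mul1e /= /product_measure1; apply: eq_integral => x _ /=.
have mx : measurable (xsection A x) by exact: measurable_xsection.
rewrite -(lebesgue_measure_affine (t * x) (oner_neq0 R) mx) normr1 mul1e.
congr lebesgue_measure; apply/seteqP; split=> y;
  by rewrite /xsection /= !inE /= mul1r.
Qed.

(** A matrix with nonzero first entry is a lower shear times a diagonal matrix times an upper shear,
    where swaps supply the second diagonal entry and the upper shear; otherwise the rows are
    exchanged first. *)
Lemma dilates_area_linear (a b c d : R) : a * d - b * c != 0 ->
  dilates_area `|a * d - b * c| (fun x : RR => (a * x.1 + b * x.2, c * x.1 + d * x.2) : RR).
Proof.
have sw := dilates_area_swap.
have gen (p q r s : R) : p != 0 -> p * s - q * r != 0 ->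
    dilates_area `|p * s - q * r| (fun x : RR => (p * x.1 + q * x.2, r * x.1 + s * x.2) : RR).
  move=> p0 D0; have D1 : (p * s - q * r) / p != 0 by rewrite mulf_neq0 // invr_neq0.
  have := dilates_area_comp (dilates_area_shear (r / p)) (dilates_area_comp (dilates_area_diag p0)
    (dilates_area_comp sw (dilates_area_comp (dilates_area_diag D1) (dilates_area_comp
      (dilates_area_shear (q / p)) sw)))).
  rewrite !mul1r mulr1 -normrM (_ : p * ((p * s - q * r) / p) = p * s - q * r); last by field.
  by congr dilates_area; apply/funext => x /=; congr pair; field.
move=> D0; have [a0|a0] := eqVneq a 0; last exact: gen.
have c0 : c != 0.
  by apply: contra_neq D0 => ->; rewrite a0 !mul0r mulr0 subr0.
have D1 : c * b - d * a != 0 by rewrite -oppr_eq0 opprB (mulrC d) (mulrC c).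
have := dilates_area_comp sw (gen c d a b c0 D1); rewrite mul1r.
by rewrite -normrN opprB (mulrC d) (mulrC c).
Qed.


(** Positive and negative parts are scaled separately; integrability keeps their difference well
    defined. *)
Lemma integral_mscale (d' : measure_display) (T' : measurableType d')
    (m : {measure set T' -> \bar R})
    (k : {nonneg R}) (D : set T') (f : T' -> \bar R) :
  measurable D -> m.-integrable D f ->
  (\int[mscale k m]_(x in D) f x = k%:num%:E * \int[m]_(x in D) f x)%E.
Proof.
move=> mD intf; have mf := measurable_int m intf.
rewrite [LHS]integralE [X in _ = (_ * X)%E]integralE.
rewrite (ge0_integral_mscale m mD k (measurable_funepos mf)) //.
rewrite (ge0_integral_mscale m mD k (measurable_funeneg mf)) //.
rewrite [RHS]muleBr //; apply: fin_num_adde_defl; rewrite fin_numN.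
by apply: integrable_fin_num => //; exact: integrable_funeneg.
Qed.

(** Change of variables: planar measure is the scaled pushforward, and an integral against a
    pushforward is pulled back along [T]. *)
Lemma integral_dilates_area c (T : RR -> RR) (D : set RR) (f : RR -> R) :
  0 <= c -> dilates_area c T -> measurable D ->
  measurable_fun setT (f : RR -> measurableTypeR R) ->
  leb.-integrable (T @^-1` D) (EFin \o (f \o T)) ->
  Rintegral leb D f = c * Rintegral leb (T @^-1` D) (f \o T).
Proof.
move=> c0 [mT hT] mD mf intf.
pose m : {measure set RR -> \bar R} :=
  measure_function_pushforward__canonical__measure_function_Measure leb mT.
have mEf : measurable_fun setT (EFin \o f) by exact/measurable_EFinP.
have intm : m.-integrable D (EFin \o f) := integrable_pushforward mT mEf intf mD.
rewrite /Rintegral.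
have -> : (\int[leb]_(x in D) (f x)%:E = \int[mscale (NngNum c0) m]_(x in D) (f x)%:E)%E.
  by apply: eq_measure_integral => A mA _; rewrite -(hT A mA).
rewrite (integral_mscale (NngNum c0) mD intm) (integral_pushforward mT mEf intf mD).
rewrite fineM //; apply: integrable_fin_num => //.
by rewrite -[X in measurable X]setTI; exact: (mT).
Qed.

(** Composed with the linear map, a monomial becomes a combination of the four monomials whose
    coefficients come from rows [i] and [j] of the matrix; the change of variables contributes the
    determinant. *)
Lemma moment_covariant : GL2_covariant (@moment_matrix R).
Proof.
move=> P phi PP uphi.
have phiE : phi = mx22 (phi ord0 ord0) (phi ord0 o1) (phi o1 ord0) (phi o1 o1).
  by apply: mx22P; rewrite mxE.
move: phiE uphi; move: (phi ord0 ord0) (phi ord0 o1) (phi o1 ord0) (phi o1 o1) => a b c d -> {phi}.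
rewrite unitmxE unitfE det22 => D0.
pose T : RR -> RR := fun x => (a * x.1 + b * x.2, c * x.1 + d * x.2).
have dT : dilates_area `|a * d - b * c| T := dilates_area_linear D0.
pose D := a * d - b * c.
(* The inverse map, which presents the image of [P] as a preimage and hence as a measurable set. *)
pose S : RR -> RR := fun x => (d / D * x.1 + - b / D * x.2, - c / D * x.1 + a / D * x.2).
have [mS _] : dilates_area `|d / D * (a / D) - (- b / D) * (- c / D)| S.
  apply: dilates_area_linear.
  rewrite (_ : _ - _ = D^-1) ?invr_neq0 //.
  by rewrite /D; field.
have ST x : S (T x) = x.
  by rewrite [RHS]surjective_pairing /S /T /D /=; congr pair; field.
have TS x : T (S x) = x.
  by rewrite [RHS]surjective_pairing /S /T /D /=; congr pair; field.
have imE : mx_image (mx22 a b c d) P = S @^-1` P.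
  apply/seteqP; split=> [_ [x Px <-]|x Px].
    by rewrite lin_act22 /preimage /= ST.
  by exists (S x) => //; rewrite lin_act22; exact: TS.
have preE : T @^-1` (S @^-1` P) = P.
  by apply/seteqP; split=> x; rewrite /preimage /= ST.
have mP := P2o_measurable PP.
have mSP : measurable (S @^-1` P : set RR).
  by rewrite -[X in measurable X]setTI; exact: mS.
have coordT x (i : 'I_2) : Defs.coord (T x) i =
    mx22 a b c d i ord0 * x.1 + mx22 a b c d i o1 * x.2.
  by rewrite /Defs.coord !mxE /=; case: (i == ord0).
apply/matrixP => i j; rewrite [RHS]mxE moment_matrixE imE.
set k1 := mx22 a b c d i ord0; set k2 := mx22 a b c d i o1.
set l1 := mx22 a b c d j ord0; set l2 := mx22 a b c d j o1.
have fE : monomial i j \o T = (fun x => k1 * l1 * monomial ord0 ord0 x +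
   (k1 * l2 * monomial ord0 o1 x + (k2 * l1 * monomial o1 ord0 x +
    k2 * l2 * monomial o1 o1 x))).
  apply/funext => x; rewrite /= /monomial !coordT -/k1 -/k2 -/l1 -/l2 /Defs.coord /=.
  by ring.
have intM := fun i j => integrable_monomial i j PP.
have intZ (k : R) u v : leb.-integrable P (EFin \o (fun x => k * monomial u v x)).
  have := integrableZl mP k (intM u v).
  by apply: eq_integrable => // x _; rewrite /= EFinM.
have intD (f g : RR -> R) : leb.-integrable P (EFin \o f) -> leb.-integrable P (EFin \o g) ->
    leb.-integrable P (EFin \o (fun x => f x + g x)).
  move=> hf hg; have := integrableD mP hf hg.
  by apply: eq_integrable => // x _; rewrite /= EFinD.
rewrite (@integral_dilates_area _ T (S @^-1` P) (monomial i j) (normr_ge0 _) dT mSP).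
- rewrite preE fE; congr (_ * _).
  rewrite (RintegralD mP (intZ _ _ _) (intD _ _ (intZ _ _ _)
    (intD _ _ (intZ _ _ _) (intZ _ _ _)))).
  rewrite (RintegralD mP (intZ _ _ _) (intD _ _ (intZ _ _ _) (intZ _ _ _))).
  rewrite (RintegralD mP (intZ _ _ _) (intZ _ _ _)).
  rewrite !RintegralZl //; try exact: intM.
  rewrite -!moment_matrixE !mul22E [(mx22 a b c d)^T _ _]mxE [(mx22 a b c d)^T o1 _]mxE.
  by rewrite -/k1 -/k2 -/l1 -/l2; ring.
- exact: measurable_monomial.
- rewrite preE fE; exact: (intD _ _ (intZ _ _ _) (intD _ _ (intZ _ _ _)
    (intD _ _ (intZ _ _ _) (intZ _ _ _)))).
Qed.

(** The integrand is nonnegative, and at least 1/16 on a box of area 1/16 inside the square. *)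
Lemma moment_kite_neq0 : moment_matrix (kite 1 1 1 1 : set (R * R)) ord0 ord0 != 0.
Proof.
have l1 := @ltr01 R.
have PK : P2o (kite 1 1 1 1 : set (R * R)) by exact: P2o_kite.
have mK := P2o_measurable PK.
pose B : set RR := `[4^-1, 2^-1]%classic `*` `[0, 4^-1]%classic.
have mB : measurable B by apply: measurableX; exact: measurable_itv.
have BK : B `<=` kite 1 1 1 1.
  move=> x [] /=; rewrite !in_itv /= => /andP[h1 h2] /andP[h3 h4].
  by apply/quadP; split; lra.
have lB : leb B = (4^-1 * 4^-1)%:E.
  rewrite /= product_measure1E; try exact: measurable_itv.
  rewrite /= !lebesgue_measure_itv /= !lte_fin.
  rewrite ifT; last by lra.
  rewrite ifT; last by lra.
  by rewrite -!EFinD -EFinM; congr EFin; field.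
have f0 x : (0 <= (monomial ord0 ord0 x)%:E :> \bar R)%E.
  by rewrite lee_fin /monomial -expr2 sqr_ge0.
have mf D : measurable_fun D (fun x : RR => (monomial ord0 ord0 x)%:E).
  by apply/measurable_EFinP; exact: measurable_monomial.
have : ((16^-1 * (4^-1 * 4^-1))%:E <= \int[leb]_(x in kite 1 1 1 1) (monomial ord0 ord0 x)%:E)%E.
  apply: (@le_trans _ _ (\int[leb]_(x in B) (monomial ord0 ord0 x)%:E)%E); last first.
    by apply: ge0_subset_integral.
  rewrite EFinM -lB -integral_cst //.
  apply: ge0_le_integral => //.
  - by move=> x _; rewrite lee_fin; lra.
  - by move=> x [/= + _]; rewrite in_itv /= lee_fin /monomial /Defs.coord /= => /andP[h1 h2]; nra.
rewrite moment_matrixE /Rintegral => h; apply/eqP => h0.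
have fin : (\int[leb]_(x in kite 1 1 1 1) (monomial ord0 ord0 x)%:E)%E \is a fin_num.
  by apply: integrable_fin_num => //; exact: integrable_monomial.
by move: h; rewrite -(fineK fin) h0 lee_fin; lra.
Qed.

End Covariance.

(** * Subtraction of a multiple of the moment matrix *)

Theorem theorem3p12 (R : realType) (mu : set (R * R) -> 'M[R]_2) :
  measurable_P2o mu -> valuation_P2o mu -> GL2_covariant mu ->
  exists k : R, forall P, P2o P -> mu P = k *: moment_matrix P.
Proof.
move=> _ muval mucov.
pose K : set (R * R) := kite 1 1 1 1.
pose k := mu K ord0 ord0 / moment_matrix K ord0 ord0; exists k => P PP.
pose nu Q := mu Q - k *: moment_matrix Q.
have nuval : valuation_P2o nu.
  move=> A B PA PB PU PI; rewrite /nu addrACA (muval _ _ PA PB PU PI) -opprD -scalerDr.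
  by rewrite (moment_valuation PA PB PU PI) scalerDr opprD addrACA.
have nucov : GL2_covariant nu.
  move=> Q phi PQ uphi; rewrite /nu mucov // moment_covariant //.
  by rewrite scalerA (mulrC k) -scalerA -scalerBr mulmxBr mulmxBl -scalemxAr -scalemxAl.
have nu11 : nu K ord0 ord0 = 0.
  have entryE (A B : 'M[R]_2) : (A - k *: B) ord0 ord0 = A ord0 ord0 - k * B ord0 ord0.
    by rewrite !mxE.
  by rewrite /nu entryE /k divfK ?subrr //; exact: moment_kite_neq0.
by apply/eqP; rewrite -subr_eq0; apply/eqP; exact: (covariant_eq0 nuval nucov nu11 PP).
Qed.
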